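(* Let $T,B:\mathfrak H\to\mathfrak K$ be closed densely defined linear operators such that $T^*B$ is a selfadjoint operator, and let $B_0:=B\upharpoonright \mathrm{dom}(T^*B)$. Then the following assertions are equivalent: (i) $T^*T\le \lambda\, T^*B$ for some $\lambda\ge 0$; (ii) $X\overline{B_0}\subseteq T$ has a solution $X\in B^+(\mathfrak K)$; where, given $X$ as in (ii), one can take $\lambda=\|X\|$ in (i). In this case $$(B_0)^*X\overline{B_0}=T^*\overline{B_0}=(B_0)^*T,$$ and, moreover, $X$ can be chosen such that $\ker T^*\subseteq\ker X$ and $\|X\|\le\lambda$. In particular, $$\Big(T^*T\le\lambda\,T^*\overline{B_0}\ \text{ for some }\lambda\ge0\ \text{ and }\ \mathrm{dom}\,T\subseteq\mathrm{dom}\,\overline{B_0}\Big)\iff \Big(T=X\overline{B_0}\ \text{ for some } X\in B^+(\mathfrak K)\Big).$$ In this case $\ker X=\ker T^*$.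
   Context: $\mathfrak H,\mathfrak K$ are complex Hilbert spaces. $B^+(\mathfrak K)$ is the set of bounded everywhere defined nonnegative selfadjoint operators on $\mathfrak K$. Products of operators have their natural (maximal) domains; $S\subseteq T$ means that $T$ extends $S$; $\overline{B_0}$ is the closure of $B_0$; $\upharpoonright$ denotes restriction. For nonnegative selfadjoint operators $C,D$ and $\lambda\ge0$, $C\le\lambda D$ means $\mathrm{dom}\,D^{1/2}\subseteq\mathrm{dom}\,C^{1/2}$ and $\|C^{1/2}x\|\le\lambda^{1/2}\|D^{1/2}x\|$ for all $x\in\mathrm{dom}\,D^{1/2}$; writing such an inequality includes the assertion that both $C$ and $D$ are nonnegative and selfadjoint.
   Formalization: The last claim, ker X = ker T^*, fails for arbitrary X (T = B the inclusion of C in C^2, X = I); it is stated as: some X in B^+(K) with T = X cl(B_0) has ker X = ker T^*, and every such X with ker T^* contained in ker X does. *)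

(* Defs.v *)
From HB Require Import structures.
From mathcomp Require Import all_boot all_order all_algebra.
From mathcomp Require Import complex.
From mathcomp Require Import all_classical all_reals all_analysis.

Set Implicit Arguments.
Unset Strict Implicit.
Unset Printing Implicit Defensive.

Import Order.TTheory GRing.Theory Num.Theory.
Import numFieldNormedType.Exports.
Local Open Scope classical_set_scope.
Local Open Scope ring_scope.
Local Open Scope complex_scope.

(* [inner] is linear in its first argument and conjugate-linear in its
   second one. *)
HB.mixin Record isHilbert (R : realType) H & CompleteNormedModule R[i] H := {
  inner : {dot H for @Num.conj R[i]} ;
  sqr_norm_inner : forall x : H, `|x| ^+ 2 = inner x x }.

#[short(type="hilbertType")]
HB.structure Definition Hilbert (R : realType) :=
  {H of isHilbert R H & CompleteNormedModule R[i] H}.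

Section Operators.
Variable R : realType.
Implicit Types H K L : hilbertType R.

(* An unbounded operator is represented by its graph, a set of pairs; hence
   inclusion of operators is inclusion of graphs, equality of operators
   (with domains) is equality of graphs, and the closure of a closable
   operator is the topological closure of its graph. *)
Definition is_linear_operator H K (T : set (H * K)) : Prop :=
  [/\ T (0, 0),
      (forall (a : R[i]) x x' y y',
         T (x, y) -> T (x', y') -> T (a *: x + x', a *: y + y')) &
      forall x y y', T (x, y) -> T (x, y') -> y = y'].

Definition dom H K (T : set (H * K)) : set H :=
  [set x | exists y, T (x, y)].

Definition ker H K (T : set (H * K)) : set H := [set x | T (x, 0)].

Definition densely_defined H K (T : set (H * K)) : Prop := dense (dom T).

Definition closed_densely_defined H K (T : set (H * K)) : Prop :=
  [/\ is_linear_operator T, closed T & densely_defined T].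

(* The product S T (first T, then S), on its maximal domain. *)
Definition op_prod H K L (S : set (K * L)) (T : set (H * K)) : set (H * L) :=
  [set p | exists y, T (p.1, y) /\ S (y, p.2)].

Definition op_restrict H K (T : set (H * K)) (D : set H) : set (H * K) :=
  [set p | D p.1 /\ T p].

(* For a densely defined operator T, this is the graph of T^*. *)
Definition adjoint H K (T : set (H * K)) : set (K * H) :=
  [set p | forall x y, T (x, y) -> inner y p.1 = inner x p.2].

Definition selfadjoint H (A : set (H * H)) : Prop :=
  [/\ is_linear_operator A, densely_defined A & A = adjoint A].

(* In R[i], [0 <= z] means that z is real and nonnegative. *)
Definition nonneg_selfadjoint H (A : set (H * H)) : Prop :=
  selfadjoint A /\ forall x y, A (x, y) -> 0 <= inner y x.

Definition is_op_sqrt H (S A : set (H * H)) : Prop :=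
  nonneg_selfadjoint S /\ op_prod S S = A.

(* C <= lambda D; the nonnegative selfadjoint square roots C2 and D2 of C
   and D exist and are unique. *)
Definition op_le H (C : set (H * H)) (lambda : R) (D : set (H * H)) : Prop :=
  [/\ nonneg_selfadjoint C, nonneg_selfadjoint D &
      exists C2 D2 : set (H * H),
        [/\ is_op_sqrt C2 C, is_op_sqrt D2 D, dom D2 `<=` dom C2 &
            forall x y z, C2 (x, y) -> D2 (x, z) ->
              `|y| <= (Num.sqrt lambda)%:C * `|z|]].

Definition bounded_op H K (X : set (H * K)) : Prop :=
  exists M : R, forall x y, X (x, y) -> `|y| <= M%:C * `|x|.

Definition Bplus H (X : set (H * H)) : Prop :=
  [/\ nonneg_selfadjoint X, dom X = setT & bounded_op X].

(* The norm of R[i]-modules takes its (real) values in R[i]. *)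
Definition opnorm H K (X : set (H * K)) : R :=
  sup [set r | exists x y, [/\ X (x, y), `|x| <= 1 & r = complex.Re `|y|]].

End Operators.

(* Main.v *)
Require Import Defs.
From HB Require Import structures.
From mathcomp Require Import all_boot all_order all_algebra.
From mathcomp Require Import complex.
From mathcomp Require Import all_classical all_reals all_analysis.
From mathcomp Require Import ring lra.

(** The operators are handled through their graphs, so each analytic fact is a
    fact on subspaces of a product of two Hilbert spaces.

    From the order to the factor.  Let D be the selfadjoint operator T^* B and
    let |T| and sqrt D be the square roots that the inequality
    T^* T <= lambda D speaks of.  Since |T| and T have the same domain and
    |(|T| x)| = |T x|, the inequality says that sqrt D x |-> T x is a well
    defined map J, bounded by sqrt lambda, on the range of sqrt D.  Extended by
    zero to the orthogonal complement and by continuity to the closure, J is an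
    everywhere defined bounded operator.  For x in the domain of D one computes
    J^* B x = sqrt D x, from (T u, B x) = (u, D x) = (sqrt D u, sqrt D x), and
    J sqrt D x = T x; hence X := J J^* satisfies X B x = T x.  It is
    nonnegative, its norm is at most lambda, and it vanishes on the orthogonal
    complement of the range of T, which is the kernel of T^*.  As X is bounded
    and T is closed, X B_0 \subseteq T passes to the closure of B_0.  This is
    [factor_exists], with [factor_closure].

    From the factor to the order.  If X B_0 \subseteq T with X bounded and
    nonnegative, then for x in the domain of D,
    |T x|^2 = |X B x|^2 <= |X| (X B x, B x) = |X| (T x, B x) = |X| (x, D x),
    by the Cauchy-Schwarz inequality for the form of X ([Bplus_sqr_le]).  The
    domain of D is a core of sqrt D, so the estimate extends to the domain of
    sqrt D ([op_le_of_form_bound]).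

    The identities.  From X B_0 \subseteq T one gets T^* \subseteq B_0^* X,
    because X is selfadjoint, and B_0^* T is contained in the adjoint of
    T^* B_0 = D, that is, in D itself.  So the operators
    T^* B, T^* cl B_0, B_0^* X cl B_0 and B_0^* T contain one another in a
    circle, and all of them are equal to D.  In the case of equality, the
    selfadjoint operator T^* cl B_0 extends the selfadjoint operator D, hence
    coincides with it, and the hypothesis on the domains turns the inclusion
    X cl B_0 \subseteq T into an equality.

    The supporting theory is von Neumann's theorem that T^* T is selfadjoint
    and that its domain is a core of T ([vonNeumann], [vonNeumann_core]), both
    consequences of the orthogonal projection onto the graph of T, and the
    existence of square roots of unbounded nonnegative selfadjoint operators
    ([op_sqrt_exists]).  The latter are built from two commuting bounded
    roots P and Q of (1 + D)^-1 and D (1 + D)^-1, as the operator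
    P u |-> Q u. *)

Import Order.TTheory GRing.Theory Num.Theory.
Import numFieldNormedType.Exports.
Set Implicit Arguments.
Unset Strict Implicit.
Unset Printing Implicit Defensive.
Local Open Scope classical_set_scope.
Local Open Scope ring_scope.
Local Open Scope complex_scope.

(** * Norms, closures and completeness *)

Section Norm.
Context {R : realType}.

(** A copy of the norm in the totally ordered field R, where linear arithmetic
    and suprema are available. *)
Definition nrm (V : normedModType R[i]) (x : V) : R := complex.Re `|x|.

Section V.
Variable V : normedModType R[i].
Implicit Types x y z : V.

Lemma nrmE x : `|x| = (nrm x)%:C.
Proof. by rewrite /nrm RRe_real // ger0_real. Qed.

Lemma nrm_ge0 x : 0 <= nrm x.
Proof. by rewrite -lecR -nrmE normr_ge0. Qed.

Lemma nrm0_eq0 x : nrm x = 0 -> x = 0.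
Proof. by move=> h; apply/normr0_eq0; rewrite nrmE h. Qed.

Lemma nrm0 : nrm (0 : V) = 0.
Proof. by rewrite /nrm normr0. Qed.

Lemma nrmN x : nrm (- x) = nrm x.
Proof. by rewrite /nrm normrN. Qed.

Lemma nrmD x y : nrm (x + y) <= nrm x + nrm y.
Proof. by rewrite -lecR rmorphD /= -!nrmE ler_normD. Qed.

Lemma nrmZ (a : R) x : nrm (a%:C *: x) = `|a| * nrm x.
Proof.
have : `|a%:C *: x| = `|a%:C| * `|x| by rewrite normrZ.
by rewrite normc_def /= expr0n /= addr0 sqrtr_sqr !nrmE -rmorphM => -[].
Qed.

Lemma nrmC x y : nrm (x - y) = nrm (y - x).
Proof. by rewrite -nrmN opprB. Qed.

Lemma nrm_tri x y z : nrm (x - z) <= nrm (x - y) + nrm (y - z).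
Proof. by rewrite -[x in nrm (x - z)](subrK y) -addrA nrmD. Qed.

Lemma closureP (A : set V) x :
  closure A x <-> forall e : R, 0 < e -> exists y, A y /\ nrm (x - y) < e.
Proof.
split=> [cl e e0|cl U].
  have /cl[y [Ay yU]] : nbhs x (ball x e%:C).
    by apply: nbhsx_ballx; rewrite ltcR.
  exists y; split=> //.
  by move: yU; rewrite -ball_normE /= nrmE ltcR.
move=> /nbhs_ballP[d /= d0 dU].
have dE : d = (complex.Re d)%:C by rewrite RRe_real // gtr0_real.
have [|y [Ay xy]] := cl (complex.Re d); first by rewrite -ltcR -dE.
exists y; split=> //; apply: dU.
by rewrite -ball_normE /= nrmE dE ltcR.
Qed.

Lemma denseP (A : set V) : dense A <-> forall x, closure A x.
Proof.
split=> [dA x U Ux|cA O [x Ox] Oo].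
  have [] := dA (interior U).
  - by exists x.
  - exact: open_interior.
  by move=> y [/interior_subset Uy Ay]; exists y.
have [|y [Ay Oy]] := cA x O; first exact: open_nbhs_nbhs.
by exists y.
Qed.

End V.

(** The norm of a product is the maximum of the norms, so that nearness can be
    tested on each component. *)
Lemma closure_pairP (V W : normedModType R[i]) (A : set (V * W)) x y :
  closure A (x, y) <-> forall e : R, 0 < e ->
    exists x' y', [/\ A (x', y'), nrm (x - x') < e & nrm (y - y') < e].
Proof.
split=> [cl e e0|cl U].
  have /cl[[x' y'] [Ay [/= xU yU]]] : nbhs (x, y) (ball (x, y) e%:C).
    by apply: nbhsx_ballx; rewrite ltcR.
  exists x', y'; split=> //.
    by move: xU; rewrite -ball_normE /= nrmE ltcR.
  by move: yU; rewrite -ball_normE /= nrmE ltcR.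
move=> /nbhs_ballP[d /= d0 dU].
have dE : d = (complex.Re d)%:C by rewrite RRe_real // gtr0_real.
have [|x' [y' [Ay xx yy]]] := cl (complex.Re d); first by rewrite -ltcR -dE.
exists (x', y'); split=> //; apply: dU.
by split; rewrite -ball_normE /= nrmE dE ltcR.
Qed.

(** Completeness with the rate of convergence kept explicit: all limits below
    are then controlled by inequalities between reals. *)
Lemma complete_cvg_rate (V : completeNormedModType R[i]) (u : nat -> V)
    (e : nat -> R) :
  (forall n m, nrm (u n - u m) <= e n + e m) ->
  (forall d : R, 0 < d -> exists N, forall n, (N <= n)%N -> e n < d) ->
  exists l : V, forall n, nrm (u n - l) <= e n.
Proof.
move=> ue e0.
have cu : cauchy (u @ \oo).
  apply: cauchy_exP => d d0.
  have dE : d = (complex.Re d)%:C by rewrite RRe_real // gtr0_real.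
  have [|N NP] := e0 (complex.Re d / 2).
    by apply: divr_gt0 => //; rewrite -ltcR -dE.
  exists (u N), N => // n /= Nn.
  rewrite -ball_normE /= nrmE dE ltcR (le_lt_trans (ue _ _)) //.
  by have := NP _ (leqnn _); have := NP _ Nn; lra.
have /cvg_ex[l ul] : cvg (u @ \oo) by exact: cauchy_cvg.
exists l => n; apply/ler_addgt0Pr => d d0.
have [N NP] := e0 (d / 2) ltac:(lra).
have d2 : 0 < (d / 2)%:C by rewrite ltcR; lra.
have [M _ MP] := cvg_ball ul d2.
have := MP (maxn M N) (leq_maxl _ _).
rewrite -ball_normE /= nrmE ltcR nrmC => h1.
have := NP _ (leq_maxr M N); have := ue n (maxn M N).
have := nrm_tri (u n) (u (maxn M N)) l; lra.
Qed.

Lemma nrm_pair (V W : normedModType R[i]) (x : V) (y : W) :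
  nrm (x, y) = Num.max (nrm x) (nrm y).
Proof.
by rewrite {1}/nrm prod_normE /= !nrmE !maxEle lecR; case: ifP.
Qed.

Lemma nrm_fst (V W : normedModType R[i]) (p : V * W) : nrm p.1 <= nrm p.
Proof. by case: p => x y; rewrite nrm_pair le_max lexx. Qed.

Lemma nrm_snd (V W : normedModType R[i]) (p : V * W) : nrm p.2 <= nrm p.
Proof. by case: p => x y; rewrite nrm_pair le_max lexx orbT. Qed.

End Norm.

(** * The real part of the inner product *)

Section Inner.
Context {R : realType}.
Section H.
Variable H : hilbertType R.
Implicit Types x y z : H.

(** The real part determines the inner product, by [inner_rip]; since subspaces
    are stable under multiplication by i, it suffices for orthogonality and for
    adjoints, and it is bilinear and symmetric over R. *)
Definition rip x y : R := complex.Re (inner x y).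

Lemma innerC x y : inner x y = (inner y x)^*.
Proof. by rewrite [LHS]hermC expr0 mul1r. Qed.

Lemma ripC x y : rip x y = rip y x.
Proof. by rewrite /rip innerC; case: (inner y x). Qed.

Lemma ripDl x y z : rip (x + y) z = rip x z + rip y z.
Proof. by rewrite /rip linearDl raddfD. Qed.

Lemma ripZl (a : R) y z : rip (a%:C *: y) z = a * rip y z.
Proof.
rewrite /rip linearZl_LR /=; case: (inner y z) => p q /=; ring.
Qed.

Lemma inner_Im x y : complex.Im (inner x y) = - rip ((0 +i* 1) *: x) y.
Proof.
rewrite /rip linearZl_LR /=; case: (inner x y) => p q /=; ring.
Qed.

Lemma sqr_nrm x : nrm x ^+ 2 = rip x x.
Proof. by have := sqr_norm_inner x; rewrite nrmE -rmorphXn /= /rip => <-. Qed.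

Lemma ripDr x y z : rip z (x + y) = rip z x + rip z y.
Proof. by rewrite !(ripC z) ripDl. Qed.

Lemma ripZr (a : R) y z : rip z (a%:C *: y) = a * rip z y.
Proof. by rewrite !(ripC z) ripZl. Qed.

Lemma ripNl y z : rip (- y) z = - rip y z.
Proof. by rewrite -scaleN1r -[-1](rmorphN1 (real_complex R)) ripZl mulN1r. Qed.

Lemma ripNr y z : rip y (- z) = - rip y z.
Proof. by rewrite !(ripC y) ripNl. Qed.

Lemma rip0l y : rip 0 y = 0.
Proof. by rewrite -(scale0r y) (ripZl 0) mul0r. Qed.

Lemma rip0r y : rip y 0 = 0.
Proof. by rewrite ripC rip0l. Qed.

(** Expands a real inner product of linear combinations with real coefficients. *)
Definition ripE := (ripDl, ripDr, ripNl, ripNr, ripZl, ripZr, rip0l, rip0r).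

Lemma rip_ge0 x : 0 <= rip x x.
Proof. by rewrite -sqr_nrm exprn_ge0 // nrm_ge0. Qed.

Lemma rip_eq0 x : rip x x = 0 -> x = 0.
Proof. by rewrite -sqr_nrm => /eqP; rewrite sqrf_eq0 => /eqP /nrm0_eq0. Qed.

(** The square of the vector (y,y) x - (x,y) y is nonnegative, and it equals
    (y,y) times the difference of the two sides squared. *)
Lemma cauchy_schwarz x y : `|rip x y| <= nrm x * nrm y.
Proof.
have h0 : 0 <= nrm x * nrm y by rewrite mulr_ge0 // nrm_ge0.
rewrite -(ler_pXn2r (n := 2)) ?nnegrE // exprMn !sqr_nrm real_normK ?num_real //.
have hy := rip_ge0 y.
have := rip_ge0 ((rip y y)%:C *: x - (rip x y)%:C *: y).
rewrite !ripE (ripC y x); set a := rip x x; set b := rip x y; set c := rip y y.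
have [c0|c0] := eqVneq c 0.
  by rewrite /b (rip_eq0 c0) rip0r expr0n /= mulr_ge0 // /a rip_ge0.
have cp : 0 < c by rewrite lt_def c0.
move=> h; rewrite -(ler_pM2l cp); nra.
Qed.

Lemma rip_le_nrm x y : rip x y <= nrm x * nrm y.
Proof. by apply: le_trans (cauchy_schwarz x y); rewrite ler_norm. Qed.

Lemma rip_inj x y : (forall z, rip z x = rip z y) -> x = y.
Proof.
move=> h; apply/eqP; rewrite -subr_eq0; apply/eqP/rip_eq0.
by rewrite ripDr ripNr h subrr.
Qed.

Lemma rip_conjZ (a : R[i]) x y : rip x (a *: y) = rip (a^* *: x) y.
Proof. by rewrite /rip linearZr_LR linearZl_LR. Qed.

Lemma inner_rip x y : inner x y = (rip x y +i* - rip ((0 +i* 1) *: x) y)%C.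
Proof. by rewrite -inner_Im /rip; case: (inner x y). Qed.

End H.

Lemma le_nrm_rip (H K : hilbertType R) (x : H) (y : K) :
  rip x x <= rip y y -> nrm x <= nrm y.
Proof. by rewrite -!sqr_nrm ler_pXn2r // nnegrE nrm_ge0. Qed.

End Inner.

(** * Subspaces and extension by continuity *)

Section Subspace.
Context {R : realType}.

Definition is_subspace (V : lmodType R[i]) (G : set V) : Prop :=
  G 0 /\ forall (a : R[i]) x y, G x -> G y -> G (a *: x + y).

Lemma subspaceD (V : lmodType R[i]) (G : set V) x y :
  is_subspace G -> G x -> G y -> G (x + y).
Proof. by move=> [_ h] Gx Gy; rewrite -(scale1r x); exact: h. Qed.

Lemma subspaceZ (V : lmodType R[i]) (G : set V) a x :
  is_subspace G -> G x -> G (a *: x).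
Proof. by move=> [G0 h] Gx; rewrite -(addr0 (_ *: _)); exact: h. Qed.

Lemma subspaceB (V : lmodType R[i]) (G : set V) x y :
  is_subspace G -> G x -> G y -> G (x - y).
Proof.
move=> sG Gx Gy; apply: subspaceD => //.
by rewrite -scaleN1r; exact: subspaceZ.
Qed.

(** Unlike [nrmZ], this one covers complex scalars. *)
Lemma nrmZC (V : normedModType R[i]) (a : R[i]) (x : V) :
  nrm (a *: x) = complex.Re `|a| * nrm x.
Proof.
have aE : `|a| = (complex.Re `|a|)%:C by rewrite RRe_real // ger0_real.
have : `|a *: x| = `|a| * `|x| by rewrite normrZ.
by rewrite aE !nrmE -rmorphM => -[].
Qed.

Lemma subspace_closure (V : normedModType R[i]) (G : set V) :
  is_subspace G -> is_subspace (closure G).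
Proof.
move=> sG; split; first by apply: subset_closure; case: sG.
move=> a x y /closureP cx /closureP cy; apply/closureP => e e0.
have a0 : 0 <= complex.Re `|a|.
  by have := normr_ge0 a; rewrite lecE => /andP[].
have a1 : 0 < complex.Re `|a| + 1 by lra.
have [|x' [Gx xx]] := cx (e / 2 / (complex.Re `|a| + 1)).
  by do 2 apply: divr_gt0 => //.
have [|y' [Gy yy]] := cy (e / 2); first by apply: divr_gt0.
exists (a *: x' + y'); split; first by case: sG => _; exact.
have -> : a *: x + y - (a *: x' + y') = a *: (x - x') + (y - y').
  by rewrite scalerBr opprD addrACA.
apply: le_lt_trans (nrmD _ _) _; rewrite nrmZC.
move: xx; rewrite ltr_pdivlMr // => xx.
have := nrm_ge0 (x - x'); nra.
Qed.

Lemma closed_closure_sub (V : topologicalType) (A B : set V) :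
  closed B -> A `<=` B -> closure A `<=` B.
Proof. by move=> /closure_id cB AB; rewrite cB; exact: closureS. Qed.

Lemma eventually_div_lt (C d : R) : 0 < C -> 0 < d ->
  exists N, forall n, (N <= n)%N -> C / n.+1%:R < d.
Proof.
move=> C0 d0; exists (Num.truncn (C / d)) => n Nn.
rewrite ltr_pdivrMr // mulrC -ltr_pdivrMr //.
apply: (lt_le_trans (truncnS_gt _)).
by rewrite ler_nat.
Qed.

(** A bounded linear relation maps Cauchy sequences to Cauchy sequences, so it
    extends by continuity to the closure of its domain.  The relation need not
    be closed, and V may itself be a product: this is what lets a bound
    relative to a graph be transported in [dominated_on_core]. *)
Lemma closure_lift (V : normedModType R[i]) (L : completeNormedModType R[i])
    (W : set (V * L)) (M : R) p :
  is_subspace W -> 0 <= M -> (forall x y, W (x, y) -> nrm y <= M * nrm x) ->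
  closure [set x | exists y, W (x, y)] p -> exists y, closure W (p, y).
Proof.
move=> sW M0 WM /closureP cp.
have H n : exists q : V * L, W q /\ nrm (p - q.1) < 1 / n.+1%:R.
  have [|x [[y Wxy] px]] := cp (1 / n.+1%:R); first exact: divr_gt0.
  by exists (x, y).
have {H}[q Hq] := choice H.
have [||l Hl] := @complete_cvg_rate R L (fun n => (q n).2)
    (fun n => (M + 1) / n.+1%:R).
- move=> n m; have := Hq n; have := Hq m.
  case: (q n) (q m) => x y [x' y'] /= [W1 d1] [W2 d2].
  have /WM : W (x' - x, y' - y) by exact: (subspaceB sW W1 W2).
  move=> hy; rewrite nrmC.
  have hx := nrm_tri x' p x.
  rewrite (nrmC x' p) in hx.
  apply: (le_trans hy).
  set a := 1 / _ in d1; set b := 1 / _ in d2.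
  have -> : (M + 1) / n.+1%:R = (M + 1) * b by rewrite /b mulrA mulr1.
  have -> : (M + 1) / m.+1%:R = (M + 1) * a by rewrite /a mulrA mulr1.
  have k0 := nrm_ge0 (p - x'); have k1 := nrm_ge0 (p - x).
  have : nrm (x' - x) <= b + a by lra.
  by move=> /(ler_wpM2l M0); lra.
- by move=> d d0; apply: eventually_div_lt => //; lra.
exists l; apply/closure_pairP => e e0.
have [N HN] := @eventually_div_lt (M + 1) e ltac:(lra) e0.
have {}HN := HN N (leqnn _).
exists (q N).1, (q N).2; have [W1 d1] := Hq N.
split; first by rewrite -surjective_pairing.
  apply: (lt_trans d1); apply: le_lt_trans HN.
  by rewrite ler_pM2r ?invr_gt0 //; lra.
by rewrite nrmC; apply: le_lt_trans (Hl N) HN.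
Qed.

End Subspace.

(** * Orthogonal projection onto a closed subspace of a product *)

Section Projection.
Context {R : realType}.
Variables H K : hilbertType R.

(** The first order condition at a minimum of a quadratic polynomial in t; the
    test value t = - L / (Q + 1) avoids a division by Q = 0. *)
Lemma linear_term_eq0 (L Q : R) :
  (forall t : R, 0 <= t * t * Q + 2 * t * L) -> L = 0.
Proof.
move=> h.
have Q0 : 0 <= Q by have := h 1; have := h (-1); lra.
have := h (- L / (Q + 1)).
set s := L / (Q + 1).
have e : L = s * (Q + 1) by rewrite /s divfK //; apply/eqP; lra.
have -> : - L / (Q + 1) = - s by rewrite mulNr.
rewrite e => k; have s0 : s * s * (Q + 2) <= 0 by lra.
have s2 : 0 <= s ^+ 2 by rewrite sqr_ge0.
suff -> : s = 0 by rewrite mul0r.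
apply/eqP; rewrite -sqrf_eq0; apply/eqP; rewrite expr2 in s2 *; nra.
Qed.

(** If (a', b') is within (r / 2)^2 of the infimum m of the squared distance and
    (a, b) exceeds it by at most r, then (a, b) is within O(r) of m.  The
    linear terms are bounded by 2 a' <= a'^2 + 1; the factor 2 m + 11 is a
    convenient constant and not a sharp one. *)
Lemma near_minimum (m r a b a' b' : R) :
  0 <= m -> 0 <= r -> r <= 2 -> 0 <= a -> 0 <= b -> 0 <= a' -> 0 <= b' ->
  a <= a' + r -> b <= b' + r -> a' ^+ 2 + b' ^+ 2 < m + (r / 2) ^+ 2 ->
  a ^+ 2 + b ^+ 2 <= m + r * (2 * m + 11).
Proof.
move=> m0 r1 r2 a0 b0 a'0 b'0 ha' hb' hf.
have ha : a ^+ 2 <= (a' + r) ^+ 2 by rewrite ler_pXn2r ?nnegrE // addr_ge0.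
have hb : b ^+ 2 <= (b' + r) ^+ 2 by rewrite ler_pXn2r ?nnegrE // addr_ge0.
have h1 : 2 * a' <= a' ^+ 2 + 1 by have := sqr_ge0 (a' - 1); rewrite sqrrB; lra.
have h2 : 2 * b' <= b' ^+ 2 + 1 by have := sqr_ge0 (b' - 1); rewrite sqrrB; lra.
have h3 : r ^+ 2 <= 2 * r by rewrite expr2 ler_wpM2r.
have h4 : 2 * a' + 2 * b' <= m + 3 by rewrite exprMn in hf; lra.
have h5 : r * (2 * a' + 2 * b') <= r * (m + 3) by rewrite ler_wpM2l.
have h6 : 0 <= r * m by rewrite mulr_ge0.
rewrite !sqrrD in ha hb; rewrite exprMn in hf; lra.
Qed.

(** The squared distance to G attains its infimum: by the parallelogram law a
    minimizing sequence is Cauchy.  The product H * K carries the maximum norm,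
    which comes from no inner product, and so the two components are treated
    side by side. *)
Lemma projection (G : set (H * K)) (h : H) (k : K) :
  is_subspace G -> closed G -> exists x y, G (x, y) /\
    forall u v, G (u, v) -> rip u (h - x) + rip v (k - y) = 0.
Proof.
move=> sG cG.
pose f (p : H * K) := nrm (h - p.1) ^+ 2 + nrm (k - p.2) ^+ 2.
have f0 p : 0 <= f p by rewrite addr_ge0 // exprn_ge0 // nrm_ge0.
pose F := [set f p | p in G].
have Fn : F !=set0 by exists (f 0), 0 => //; case: sG.
have Fl : has_lbound F by exists 0 => _ [p _ <-].
pose m := inf F.
have mle p : G p -> m <= f p by move=> Gp; apply: ge_inf => //; exists p.
have Hn n : exists p, G p /\ f p < m + (1 / n.+1%:R) ^+ 2.
  have [|_ [p Gp <-] pm] := @inf_adherent _ F ((1 / n.+1%:R) ^+ 2) _ (conj Fn Fl).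
    by rewrite exprn_gt0 // divr_gt0.
  by exists p.
have {Hn}[q Hq] := choice Hn.
(* The parallelogram law at q n and q n', whose midpoint is in G. *)
have par n n' : nrm ((q n).1 - (q n').1) ^+ 2 + nrm ((q n).2 - (q n').2) ^+ 2
    <= (2 / n.+1%:R + 2 / n'.+1%:R) ^+ 2.
  have [G1 f1] := Hq n; have [G2 f2] := Hq n'.
  have /mle : G ((2^-1)%:C *: (q n + q n')).
    by apply: subspaceZ => //; exact: subspaceD.
  move: f1 f2; rewrite /f !sqr_nrm.
  have -> : 2 / n.+1%:R = 2 * (1 / n.+1%:R) :> R by rewrite mulrA mulr1.
  have -> : 2 / n'.+1%:R = 2 * (1 / n'.+1%:R) :> R by rewrite mulrA mulr1.
  set a := 1 / _; set b := 1 / _.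
  have a0 : 0 <= a by rewrite divr_ge0.
  have b0 : 0 <= b by rewrite divr_ge0.
  case: (q n) (q n') => x y [x' y'] /=; rewrite !ripE.
  rewrite (ripC x' h) (ripC x h) (ripC x' x) (ripC y' k) (ripC y k) (ripC y' y).
  nra.
have rate0 (d : R) : 0 < d -> exists N, forall n, (N <= n)%N -> 2 / n.+1%:R < d.
  exact: eventually_div_lt.
have sq (a b c : R) : 0 <= a -> 0 <= c -> a ^+ 2 + b ^+ 2 <= c ^+ 2 -> a <= c.
  move=> a0 c0 hh; rewrite -(ler_pXn2r (n := 2)) ?nnegrE //.
  by have := sqr_ge0 b; lra.
have r0 n : 0 <= 2 / n.+1%:R :> R by exact: divr_ge0.
have [||x Hx] := @complete_cvg_rate R H (fun n => (q n).1)
   (fun n => 2 / n.+1%:R).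
  move=> n n'; apply: sq (par n n'); rewrite ?nrm_ge0 ?addr_ge0 //.
  exact: rate0.
have [||y Hy] := @complete_cvg_rate R K (fun n => (q n).2)
   (fun n => 2 / n.+1%:R).
  move=> n n'; have := par n n'; rewrite addrC.
  by apply: sq; rewrite ?nrm_ge0 ?addr_ge0.
  exact: rate0.
have Gxy : G (x, y).
  rewrite (closure_id G).1 //; apply/closure_pairP => e e0.
  have [N /(_ N (leqnn _)) HN] := rate0 e e0.
  exists (q N).1, (q N).2; split.
  - by rewrite -surjective_pairing; case: (Hq N).
  - by rewrite nrmC (le_lt_trans (Hx N)).
  - by rewrite nrmC (le_lt_trans (Hy N)).
have fm : f (x, y) <= m.
  apply/ler_addgt0Pr => d d0.
  have m0 : 0 <= m by apply: lb_le_inf => // _ [p _ <-].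
  have [|N /(_ N (leqnn _)) HN] := @eventually_div_lt R (2 * (2 * m + 11)) d _ d0.
    by lra.
  have [_] := Hq N; rewrite /f /=; have := Hx N; have := Hy N.
  case: (q N) => x' y' /= hy hx.
  have := nrm_tri h x' x; have := nrm_tri k y' y.
  move: hx hy HN.
  have -> : (2 * (2 * m + 11)) / N.+1%:R = (2 / N.+1%:R) * (2 * m + 11).
    by rewrite mulrAC.
  have -> : 1 / N.+1%:R = (2 / N.+1%:R) / 2 :> R.
    by rewrite mulrAC divff.
  have : 2 / N.+1%:R <= 2 :> R.
    by rewrite ler_pdivrMr // ler_peMr // ler1n.
  have := r0 N; set r := 2 / _ => r1 r2 hx hy hd ty tx.
  have := nrm_ge0 (h - x'); have := nrm_ge0 (k - y').
  have := nrm_ge0 (h - x); have := nrm_ge0 (k - y).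
  set a := nrm (h - x) in tx *; set b := nrm (k - y) in ty *.
  set a' := nrm (h - x') in tx *; set b' := nrm (k - y') in ty *.
  move=> b0 a0 b'0 a'0 hf.
  have ha : a <= a' + r by apply: le_trans tx _; rewrite lerD2l.
  have hb : b <= b' + r by apply: le_trans ty _; rewrite lerD2l.
  apply: le_trans (near_minimum m0 r1 r2 a0 b0 a'0 b'0 ha hb hf) _.
  by rewrite lerD2l ltW.
exists x, y; split=> [|u v Guv]; first exact: Gxy.
apply: (@linear_term_eq0 (rip u (h - x) + rip v (k - y)) (rip u u + rip v v)) => t.
have hm : m <= f (x - t%:C *: u, y - t%:C *: v).
  exact/mle/(subspaceB sG Gxy (subspaceZ t%:C sG Guv)).
have := le_trans fm hm; rewrite /f !sqr_nrm /= !ripE.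
rewrite (ripC x h) (ripC y k) (ripC u x) (ripC v y) (ripC h u) (ripC k v).
clear; nra.
Qed.

End Projection.

(** * Adjoints, selfadjoint operators and the theorem of von Neumann *)

Section Operators.
Context {R : realType}.
Implicit Types H K L : hilbertType R.

Lemma op_subspace H K (T : set (H * K)) :
  is_linear_operator T -> is_subspace T.
Proof.
by move=> [T0 TD _]; split=> // a [x y] [x' y']; exact: TD.
Qed.

Lemma op_fun H K (T : set (H * K)) x y y' :
  is_linear_operator T -> T (x, y) -> T (x, y') -> y = y'.
Proof. by move=> [_ _]; apply. Qed.

Lemma subspace_op H K (T : set (H * K)) :
  is_subspace T -> (forall y, T (0, y) -> y = 0) -> is_linear_operator T.
Proof.
move=> sT T0; split; first by case: sT.
- by move=> a x x' y y' h h'; exact: (sT.2 a (x, y) (x', y') h h').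
- move=> x y y' h h'; apply/eqP; rewrite -subr_eq0; apply/eqP/T0.
  rewrite -(subrr x); exact: subspaceB sT h h'.
Qed.

Lemma dom_subspace H K (T : set (H * K)) : is_subspace T -> is_subspace (dom T).
Proof.
move=> sT; split; first by exists 0; case: sT.
by move=> a x x' [y h] [y' h']; exists (a *: y + y'); exact: sT.2 a _ _ h h'.
Qed.

Lemma prod_subspace H K L (S : set (K * L)) (T : set (H * K)) :
  is_subspace S -> is_subspace T -> is_subspace (op_prod S T).
Proof.
move=> sS sT; split; first by exists 0; split; [case: sT|case: sS].
move=> a [x z] [x' z'] /= [y [/= h k]] [y' [/= h' k']].
exists (a *: y + y'); split; first exact: sT.2 a _ _ h h'.
exact: sS.2 a _ _ k k'.
Qed.

Lemma restrict_subspace H K (T : set (H * K)) (D : set H) :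
  is_subspace D -> is_subspace T -> is_subspace (op_restrict T D).
Proof.
move=> sD sT; split; first by split; [case: sD|case: sT].
move=> a p p' [h k] [h' k']; split; first exact: sD.2 a _ _ h h'.
exact: sT.2 a _ _ k k'.
Qed.

(** Multiplying a vector of T by i exchanges the real and the imaginary part of
    the condition that defines the adjoint. *)
Lemma adjoint_rip H K (T : set (H * K)) x y : is_subspace T ->
  adjoint T (x, y) <-> forall u v, T (u, v) -> rip v x = rip u y.
Proof.
move=> sT; split=> [h u v /h|h u v Tuv]; first by rewrite /rip /= => ->.
rewrite /= !inner_rip (h u v Tuv); congr (_ +i* - _)%C.
exact: h (subspaceZ _ sT Tuv).
Qed.

Lemma adjoint_subspace H K (T : set (H * K)) : is_subspace (adjoint T).
Proof.
split=> [u v _|a [x y] [x' y'] h h' u v Tuv] /=; first by rewrite !linear0r.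
by rewrite !linearDr !linearZr_LR /= (h _ _ Tuv) (h' _ _ Tuv).
Qed.

Lemma adjointS H K (S T : set (H * K)) : S `<=` T -> adjoint T `<=` adjoint S.
Proof. by move=> ST p h u v /ST; exact: h. Qed.

Lemma adjoint_closed H K (T : set (H * K)) : is_subspace T -> closed (adjoint T).
Proof.
move=> sT; apply/closure_id; apply/seteqP; split; first exact: subset_closure.
move=> [x y] /closure_pairP cl; apply/(adjoint_rip _ _ sT) => u v Tuv.
apply/eqP; rewrite -subr_eq0 -normr_le0; apply/ler_addgt0Pr => d d0.
have c0 : 0 < nrm u + nrm v + 1.
  by have := nrm_ge0 u; have := nrm_ge0 v; lra.
have [|x' [y' [/(adjoint_rip _ _ sT) h hx hy]]] := cl (d / (nrm u + nrm v + 1)).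
  exact: divr_gt0.
have -> : rip v x - rip u y = rip v (x - x') - rip u (y - y').
  by rewrite !ripE (h u v Tuv); ring.
rewrite add0r; apply: le_trans (ler_normB _ _) _.
have := cauchy_schwarz v (x - x'); have := cauchy_schwarz u (y - y').
have := ler_wpM2l (nrm_ge0 v) (ltW hx); have := ler_wpM2l (nrm_ge0 u) (ltW hy).
have : d / (nrm u + nrm v + 1) * (nrm u + nrm v + 1) = d by rewrite divfK ?gt_eqF.
by have : 0 < d / (nrm u + nrm v + 1) by [exact: divr_gt0]; lra.
Qed.

(** A vector of the adjoint over 0 is orthogonal to the domain of T, which is
    dense. *)
Lemma adjoint_fun H K (T : set (H * K)) :
  densely_defined T -> forall y, adjoint T (0, y) -> y = 0.
Proof.
move=> /denseP dT y h; apply: nrm0_eq0; apply/eqP; rewrite eq_le nrm_ge0 andbT.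
apply/ler_addgt0Pr => d d0; rewrite add0r.
have [//|x [[z Txz] hx]] := (closureP _ _).1 (dT y) d.
have : rip x y = 0 by rewrite /rip -(h _ _ Txz) linear0r.
have := rip_le_nrm (y - x) y; rewrite ripDl ripNl => + e; rewrite {}e -sqr_nrm.
have := nrm_ge0 y; nra.
Qed.

(** Project onto the closure of D, seen as the subspace cl D * 0 of H * H: the
    residual is orthogonal to D. *)
Lemma dense_orth H (D : set H) : is_subspace D ->
  (forall z, (forall u, D u -> rip u z = 0) -> z = 0) -> dense D.
Proof.
move=> sD orth; apply/denseP => h.
pose G : set (H * H) := [set p | closure D p.1 /\ p.2 = 0].
have sG : is_subspace G.
  have sc := subspace_closure sD.
  split; first by split=> //; case: sc.
  move=> a p p' [h1 e1] [h2 e2]; split; first exact: sc.2.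
  by rewrite /= e1 e2 scaler0 addr0.
have cG : closed G.
  apply/closure_id/seteqP; split; first exact: subset_closure.
  move=> [x y] /closure_pairP cl; split=> /=.
    rewrite (closure_id (closure D)).1; last exact: closed_closure.
    apply/closureP => e e0; have [x' [y' [[/= h1 _] hx _]]] := cl e e0.
    by exists x'.
  apply: nrm0_eq0; apply/eqP; rewrite eq_le nrm_ge0 andbT.
  apply/ler_addgt0Pr => d d0; rewrite add0r.
  have [x' [y' [[/= _ ->] _]]] := cl d d0.
  by rewrite subr0 => /ltW.
have [x [y [[/= Dx _] hxy]]] := projection h 0 sG cG.
suff -> : h = x by [].
apply/eqP; rewrite -subr_eq0; apply/eqP/orth => u Du.
have := hxy u 0; rewrite rip0l addr0; apply.
by split=> //=; exact: subset_closure.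
Qed.

(** The residual (a, b) of the projection of a vector of T^** onto the graph of T
    satisfies (b, - a) in T^*; testing (a, b), itself a vector of T^**,
    against it gives - |a|^2 = |b|^2. *)
Lemma biadjoint H K (T : set (H * K)) :
  is_subspace T -> closed T -> adjoint (adjoint T) = T.
Proof.
move=> sT cT; have sA := adjoint_subspace T.
apply/seteqP; split=> [[x y] h|[x y] Txy]; last first.
  apply/(adjoint_rip _ _ sA) => u v /(adjoint_rip _ _ sT) h.
  by rewrite ripC -(h _ _ Txy) ripC.
have [u [v [Tuv p]]] := projection x y sT cT.
have hA : adjoint T (y - v, - (x - u)).
  by apply/(adjoint_rip _ _ sT) => a b /p; rewrite ripNr; lra.
have /(adjoint_rip _ _ sA) h' := h.
have := h' _ _ hA; have := (adjoint_rip _ _ sT).1 hA _ _ Tuv.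
rewrite !ripNl !ripNr => e1 e2.
have := rip_ge0 (x - u); have := rip_ge0 (y - v).
have e3 : rip (x - u) (x - u) + rip (y - v) (y - v) = 0.
  rewrite [in rip (x - u) _]ripDr [in rip (y - v) _]ripDr !ripNr.
  by rewrite (ripC (y - v) v) (ripC (x - u) u); lra.
move=> h1 h2.
have /rip_eq0/eqP : rip (x - u) (x - u) = 0 by lra.
have /rip_eq0/eqP : rip (y - v) (y - v) = 0 by lra.
by rewrite !subr_eq0 => /eqP -> /eqP ->.
Qed.

(** A vector z orthogonal to the domain of T^* satisfies (0, z) in T^** = T. *)
Lemma adjoint_dense H K (T : set (H * K)) :
  is_linear_operator T -> closed T -> densely_defined (adjoint T).
Proof.
move=> lT cT; have sT := op_subspace lT.
apply: dense_orth; first exact/dom_subspace/adjoint_subspace.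
move=> z hz.
suff : adjoint (adjoint T) (0, z).
  by rewrite biadjoint // => /op_fun; apply=> //; case: sT.
apply/(adjoint_rip _ _ (adjoint_subspace T)) => u v h.
by rewrite rip0r hz //; exists v.
Qed.

Lemma adjoint_cdd H K (T : set (H * K)) :
  closed_densely_defined T -> closed_densely_defined (adjoint T).
Proof.
move=> [lT cT dT]; split.
- by apply: subspace_op (adjoint_subspace T) _; exact: adjoint_fun.
- exact/adjoint_closed/op_subspace.
- exact: adjoint_dense.
Qed.

(** By continuity the domain of a bounded closed operator is closed. *)
Lemma closed_bounded_dom H K (T : set (H * K)) (M : R) :
  closed_densely_defined T -> 0 <= M ->
  (forall x y, T (x, y) -> nrm y <= M * nrm x) -> dom T = setT.
Proof.
move=> [lT cT /denseP dT] M0 TM; apply/seteqP; split=> // x _.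
have [y] := closure_lift (op_subspace lT) M0 TM (dT x).
by rewrite -(closure_id T).1 // => h; exists y.
Qed.

(** Approximate y by u in the domain of T: then |y|^2 is close to
    (u, y) = (T u, x), which is at most M |u| |x|. *)
Lemma adjoint_bounded H K (T : set (H * K)) (M : R) :
  densely_defined T -> 0 <= M ->
  (forall x y, T (x, y) -> nrm y <= M * nrm x) ->
  forall x y, adjoint T (x, y) -> nrm y <= M * nrm x.
Proof.
move=> /denseP dT M0 TM x y h.
have key e : 0 < e -> nrm y * nrm y <= (M * nrm x) * nrm y + e.
  move=> e0.
  have c0 : 0 < nrm y + M * nrm x + 1.
    have := mulr_ge0 M0 (nrm_ge0 x); have := nrm_ge0 y; lra.
  have [|u [[v Tuv] hu]] := (closureP _ _).1 (dT y) (e / (nrm y + M * nrm x + 1)).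
    exact: divr_gt0.
  have e1 : rip u y = rip v x by rewrite /rip (h _ _ Tuv).
  have h1 := rip_le_nrm v x.
  have h2 := ler_wpM2r (nrm_ge0 x) (TM _ _ Tuv).
  have h3 : nrm u <= nrm y + nrm (y - u).
    by have := nrm_tri u y 0; rewrite !subr0 nrmC; lra.
  have h4 := rip_le_nrm (y - u) y; rewrite ripDl ripNl -sqr_nrm e1 in h4.
  have h5 := ler_wpM2l M0 (ler_wpM2r (nrm_ge0 x) h3).
  move: hu; rewrite ltr_pdivlMr // => hu.
  have := nrm_ge0 (y - u); rewrite expr2 in h4; nra.
have : nrm y * nrm y <= (M * nrm x) * nrm y by apply/ler_addgt0Pr => e /key.
have [->|y0] := eqVneq (nrm y) 0; first by rewrite mulr_ge0 ?nrm_ge0.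
by rewrite ler_pM2r // lt_def y0 nrm_ge0.
Qed.

Lemma selfadjoint_rip H (A : set (H * H)) : selfadjoint A ->
  forall x y u v, A (x, y) -> A (u, v) -> rip y u = rip x v.
Proof.
move=> [lA dA eA] x y u v h; rewrite {1}eA => h'.
exact: (adjoint_rip _ _ (op_subspace lA)).1 h' _ _ h.
Qed.

Lemma nonneg_rip H (A : set (H * H)) : nonneg_selfadjoint A ->
  forall x y, A (x, y) -> 0 <= rip y x.
Proof. by move=> [_ h] x y /h; rewrite lecE /rip => /andP[]. Qed.

(** For a selfadjoint operator the form is real, so that only its real part has to
    be examined. *)
Lemma nonneg_selfadjointP H (A : set (H * H)) : selfadjoint A ->
  (forall x y, A (x, y) -> 0 <= rip y x) -> nonneg_selfadjoint A.
Proof.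
move=> sA pA; split=> // x y h; rewrite inner_rip lecE /=.
rewrite pA // andbT oppr_eq0; apply/eqP.
have [lA _ _] := sA; have oA := op_subspace lA.
have hi := subspaceZ (0 +i* 1)%C oA h.
have e1 := selfadjoint_rip sA hi h.
have e : rip ((0 +i* 1)%C *: x) y = - rip ((0 +i* 1)%C *: y) x.
  by rewrite /rip !linearZl_LR /= (innerC y x); case: (inner x y) => p q /=; ring.
lra.
Qed.

Lemma selfadjoint_closed H (A : set (H * H)) : selfadjoint A -> closed A.
Proof. by move=> [lA _ ->]; exact/adjoint_closed/op_subspace. Qed.

Lemma selfadjoint_cdd H (A : set (H * H)) :
  selfadjoint A -> closed_densely_defined A.
Proof. by move=> sA; have cA := selfadjoint_closed sA; case: sA. Qed.

(** Selfadjoint operators are maximal among selfadjoint operators, because taking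
    adjoints reverses inclusions. *)
Lemma selfadjoint_max H (A B : set (H * H)) :
  selfadjoint A -> selfadjoint B -> A `<=` B -> A = B.
Proof.
move=> [_ _ eA] [_ _ eB] AB; apply/seteqP; split=> //.
by rewrite eA eB; exact: adjointS.
Qed.

(** A vector (x, y) of the adjoint agrees with the vector (u, v) of A for which
    u + v = x + y, since x - u is orthogonal to the range of I + A. *)
Lemma nonneg_selfadjoint_of_range H (A : set (H * H)) : is_linear_operator A ->
  (forall x y u v, A (x, y) -> A (u, v) -> rip y u = rip x v) ->
  (forall x y, A (x, y) -> 0 <= rip y x) ->
  (forall h, exists x y, A (x, y) /\ x + y = h) -> nonneg_selfadjoint A.
Proof.
move=> lA symA posA rA; have sA := op_subspace lA.
apply: nonneg_selfadjointP => //; split=> //.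
  apply: dense_orth; first exact: dom_subspace.
  move=> z hz; have [x [y [Axy e]]] := rA z.
  have /hz : dom A x by exists y.
  rewrite -e ripDr (ripC x y) => h; have := posA _ _ Axy; have := rip_ge0 x.
  move=> h1 h2; have x0 : x = 0 by apply: rip_eq0; lra.
  rewrite x0 in Axy *; rewrite add0r.
  by apply: (op_fun lA Axy); case: sA.
apply/seteqP; split=> [[x y] h|[x y] h].
  by apply/(adjoint_rip _ _ sA) => u v h'; exact: symA h' h.
have [u [v [Auv e]]] := rA (x + y).
suff xu : x = u.
  by move: e; rewrite xu => /addrI <-.
apply/rip_inj => z; have [a [b [Aab <-]]] := rA z.
have := (adjoint_rip _ _ sA).1 h _ _ Aab; have := symA _ _ _ _ Aab Auv.
have : rip a (u + v) = rip a (x + y) by rewrite e.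
by rewrite !ripE; lra.
Qed.

(** Projecting (h, 0) onto the graph of T yields x with T x in the domain of T^*
    and x + T^* T x = h.  So I + T^* T is onto, and
    [nonneg_selfadjoint_of_range] applies. *)
Lemma vonNeumann H K (T : set (H * K)) : closed_densely_defined T ->
  (forall h, exists x y, op_prod (adjoint T) T (x, y) /\ x + y = h) /\
  nonneg_selfadjoint (op_prod (adjoint T) T).
Proof.
move=> cT; have [lT clT dT] := cT; have sT := op_subspace lT.
have [lA _ _] := adjoint_cdd cT.
have range h : exists x y, op_prod (adjoint T) T (x, y) /\ x + y = h.
  have [x [y [Txy p]]] := projection h 0 sT clT.
  exists x, (h - x); split; last by rewrite addrC subrK.
  exists y; split=> //=; apply/(adjoint_rip _ _ sT) => u v /p.
  by rewrite sub0r ripNr; lra.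
split=> //; apply: nonneg_selfadjoint_of_range => //.
- apply: subspace_op.
    exact: prod_subspace (adjoint_subspace T) sT.
  move=> y [z [/= T0 h]].
  have z0 : z = 0 by apply: op_fun lT T0 _; case: sT.
  by rewrite z0 in h; apply: op_fun lA h _; case: (adjoint_subspace T).
- move=> x y u v [a [/= Ta /(adjoint_rip _ _ sT) ha]].
  move=> [b [/= Tb /(adjoint_rip _ _ sT) hb]].
  by rewrite ripC -(ha _ _ Tb) -(hb _ _ Ta) ripC.
- move=> x y [a [/= Ta /(adjoint_rip _ _ sT) ha]].
  by rewrite ripC -(ha _ _ Ta) rip_ge0.
Qed.

(** A vector (a, b) of T that is orthogonal, in the graph, to the restriction of T
    to the domain of T^* T satisfies (a, u + T^* T u) = 0 for all u, and
    I + T^* T is onto. *)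
Lemma vonNeumann_core H K (T : set (H * K)) : closed_densely_defined T ->
  T `<=` closure (op_restrict T (dom (op_prod (adjoint T) T))).
Proof.
move=> cT; have [lT clT dT] := cT; have sT := op_subspace lT.
set G := op_restrict _ _ => -[x y] Txy.
have sG : is_subspace G.
  apply: restrict_subspace => //; apply/dom_subspace/prod_subspace => //.
  exact: adjoint_subspace.
have cG : closure G `<=` T by apply: closed_closure_sub clT _ => p [].
have [u [v [Guv p]]] := projection x y (subspace_closure sG) (@closed_closure _ G).
have Tuv := cG _ Guv.
have Td := subspaceB sT Txy Tuv.
suff xu : x = u by rewrite xu in Txy *; rewrite (op_fun lT Txy Tuv).
apply/eqP; rewrite -subr_eq0; apply/eqP/rip_eq0.
have [a [b [[c [/= Tc hc]] e]]] := (vonNeumann cT).1 (x - u).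
have := (adjoint_rip _ _ sT).1 hc _ _ Td.
have /p : closure G (a, c).
  by apply: subset_closure; split=> //; exists b, c.
rewrite (ripC c) => h1 h2; rewrite -{2}e ripDr (ripC _ a); lra.
Qed.

(** The domain of S^* S is a core of S.  The map (x, S x) |-> T x on this core is
    bounded, hence extends to the graph of S, and T is closed. *)
Lemma dominated_on_core H K L (S : set (H * K)) (T : set (H * L)) (c : R) :
  closed_densely_defined S -> closed_densely_defined T -> 0 <= c ->
  (forall x z, S (x, z) -> dom (op_prod (adjoint S) S) x ->
     exists y, T (x, y) /\ nrm y <= c * nrm z) ->
  forall x z, S (x, z) -> exists y, T (x, y) /\ nrm y <= c * nrm z.
Proof.
move=> cS cT c0 ST x z Sxz.
have [lT clT _] := cT; have [lS _ _] := cS.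
have sT := op_subspace lT; have sS := op_subspace lS.
set G := op_restrict S (dom (op_prod (adjoint S) S)).
have sG : is_subspace G.
  apply: restrict_subspace => //; apply/dom_subspace/prod_subspace => //.
  exact: adjoint_subspace.
pose W : set ((H * K) * L) := [set p | G p.1 /\ T (p.1.1, p.2)].
have WM (p : H * K) y : W (p, y) -> nrm y <= c * nrm p.2.
  move=> [/= [h1 h2] h3]; rewrite (surjective_pairing p) in h2.
  by have [y' [/(op_fun lT h3) -> ]] := ST _ _ h2 h1.
have [||||y cy] := @closure_lift R (H * K)%type L W c (x, z).
- split; first by split; [case: sG|case: sT].
  move=> a p q [h1 h2] [h3 h4]; split; first exact: sG.2.
  exact: sT.2 a _ _ h2 h4.
- by [].
- by move=> p y /WM h; apply: le_trans h _; rewrite ler_wpM2l // nrm_snd.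
- have := vonNeumann_core cS Sxz; apply: closureS => -[u v] [/= h1 h2].
  by have [y [h _]] := ST _ _ h2 h1; exists y.
exists y; split.
  rewrite (closure_id T).1 //; apply/closure_pairP => e e0.
  have [[u v] [y' [[/= _ h] h1 h2]]] := (closure_pairP _ _ _).1 cy e e0.
  exists u, y'; split=> //; apply: le_lt_trans h1.
  exact: (nrm_fst (x - u, z - v)).
apply/ler_addgt0Pr => d d0.
have [|[u v] [y' [/WM /= h h1 h2]]] := (closure_pairP _ _ _).1 cy (d / (c + 1)).
  by apply: divr_gt0 => //; lra.
have h3 : nrm (z - v) < d / (c + 1).
  by apply: le_lt_trans h1; exact: (nrm_snd (x - u, z - v)).
have := nrm_tri y y' 0; have := nrm_tri v z 0; rewrite !subr0 (nrmC v).
move=> k1 k2; have := ler_wpM2l c0 k1; have := ler_wpM2l c0 (ltW h3).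
by have : d / (c + 1) * (c + 1) = d by [rewrite divfK // gt_eqF //; lra]; lra.
Qed.

End Operators.

(** * Square roots of bounded operators *)

Section BoundedRoot.
Context {R : realType}.
Variable H : hilbertType R.
Implicit Types (f g : H -> H) (x y z : H).

Definition linear_map f := forall (a : R[i]) x y, f (a *: x + y) = a *: f x + f y.

(** Bounded operators that are everywhere defined appear as functions here, since
    they are iterated and composed. *)
Definition contraction_sym f :=
  [/\ linear_map f, (forall x, nrm (f x) <= nrm x) &
      forall x y, rip (f x) y = rip x (f y)].

Lemma linear_mapD f x y : linear_map f -> f (x + y) = f x + f y.
Proof. by move=> lf; rewrite -{1}(scale1r x) lf scale1r. Qed.

Lemma linear_map0 f : linear_map f -> f 0 = 0.
Proof.
by move=> lf; apply: (@addIr _ (f 0)); rewrite -linear_mapD // !addr0 add0r.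
Qed.

Lemma linear_mapZ f a x : linear_map f -> f (a *: x) = a *: f x.
Proof. by move=> lf; rewrite -{1}(addr0 (a *: x)) lf linear_map0 // addr0. Qed.

Lemma linear_mapB f x y : linear_map f -> f (x - y) = f x - f y.
Proof. by move=> lf; rewrite linear_mapD // -scaleN1r linear_mapZ // scaleN1r. Qed.

Lemma rip_contraction_le f x : contraction_sym f -> rip (f x) x <= rip x x.
Proof.
move=> [_ cf _]; apply: le_trans (rip_le_nrm _ _) _.
by rewrite -sqr_nrm expr2 ler_wpM2r // nrm_ge0.
Qed.

Lemma complement_sym f : contraction_sym f ->
  forall x y, rip (x - f x) y = rip x (y - f y).
Proof. by move=> [_ _ sf] x y; rewrite !ripE sf. Qed.

Variable N : H -> H.
Hypothesis cN : contraction_sym N.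

(** The iteration of [iterate] for the number N = 1.  It converges to 1, and its
    increments bound those of the operators. *)
Fixpoint majorant (n : nat) : R :=
  if n is n'.+1 then (1 + majorant n' ^+ 2) / 2 else 0.

Lemma majorant_ge0 n : 0 <= majorant n.
Proof. by elim: n => //= n h; have := sqr_ge0 (majorant n); lra. Qed.

Lemma majorant_le1 n : majorant n <= 1.
Proof.
elim: n => //= n h; have h0 := majorant_ge0 n.
have : majorant n ^+ 2 <= 1 by rewrite expr_le1. lra.
Qed.

Lemma majorantS n : majorant n <= majorant n.+1.
Proof. by have := sqr_ge0 (1 - majorant n); rewrite sqrrB /=; lra. Qed.

(** With b = 1 - majorant n the recursion reads b |-> b - b^2 / 2. *)
Lemma majorant_near1 n : 1 - majorant n <= 2 / n.+2%:R.
Proof.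
elim: n => [|n h]; first by rewrite subr0 divff.
have h0 := majorant_ge0 n; have h1 := majorant_le1 n.
have -> : 1 - majorant n.+1 = (1 - majorant n) - (1 - majorant n) ^+ 2 / 2.
  by rewrite sqrrB /=; lra.
have p2 : 0 < n.+2%:R :> R by rewrite ltr0n.
have e : n.+3%:R = n.+2%:R + 1 :> R by rewrite natr1.
have q1 : 1 <= n.+2%:R :> R by rewrite ler1n.
rewrite e; move: h; set t := n.+2%:R in p2 q1 *; rewrite !ler_pdivlMr // ; last lra.
set b := 1 - majorant n => h; have b0 : 0 <= b by rewrite /b; lra.
have b1 : b <= 1 by rewrite /b; lra.
have := ler_wpM2l b0 h; rewrite expr2; nra.
Qed.

(** Picard iteration for Y = (N + Y^2) / 2, the equation which expresses that
    1 - Y is a square root of 1 - N. *)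
Fixpoint iterate (n : nat) (x : H) : H :=
  if n is n'.+1 then (2^-1)%:C *: (N x + iterate n' (iterate n' x)) else 0.

Lemma iterate_linear n : linear_map (iterate n).
Proof.
have [lN _ _] := cN.
elim: n => [|n h] a x y /=; first by rewrite scaler0 addr0.
rewrite lN !h [a *: (_%:C *: _)]scalerA (mulrC a) -scalerA -scalerDr.
by congr (_ *: _); rewrite scalerDr addrACA.
Qed.

Lemma iterate_bound n x : nrm (iterate n x) <= majorant n * nrm x.
Proof.
have [_ bN _] := cN.
elim: n x => [|n h] x /=; first by rewrite nrm0 mul0r.
rewrite nrmZ ger0_norm; last by rewrite invr_ge0.
have := nrmD (N x) (iterate n (iterate n x)); have := bN x.
have := ler_wpM2l (majorant_ge0 n) (h x); have := h (iterate n x).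
by rewrite expr2; lra.
Qed.

Lemma iterate_sym n x y : rip (iterate n x) y = rip x (iterate n y).
Proof.
have [_ _ sN] := cN.
elim: n x y => [|n h] x y /=; first by rewrite rip0l rip0r.
by rewrite ripZl ripZr !ripE sN !h.
Qed.

Lemma iterate_comm n (C : H -> H) : linear_map C ->
  (forall x, C (N x) = N (C x)) -> forall x, C (iterate n x) = iterate n (C x).
Proof.
move=> lC CN; elim: n => [|n h] x /=; first exact: linear_map0.
by rewrite linear_mapZ // linear_mapD // CN !h.
Qed.

(** All iterates are polynomials in N. *)
Lemma iterate_commute n m x :
  iterate n (iterate m x) = iterate m (iterate n x).
Proof.
have [lN _ _] := cN.
apply: iterate_comm; first exact: iterate_linear.
by move=> y; rewrite (iterate_comm n lN).
Qed.

(** As the iterates commute, Y_(n+2) - Y_(n+1) is half of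
    (Y_(n+1) + Y_n) (Y_(n+1) - Y_n), and the majorant satisfies the same
    identity. *)
Lemma iterate_step n x :
  nrm (iterate n.+1 x - iterate n x) <= (majorant n.+1 - majorant n) * nrm x.
Proof.
elim: n x => [|n h] x.
  rewrite !subr0; exact: (iterate_bound 1).
have -> : iterate n.+2 x - iterate n.+1 x = (2^-1)%:C *:
   (iterate n.+1 (iterate n.+1 x - iterate n x) +
    iterate n (iterate n.+1 x - iterate n x)).
  have ll k s t : iterate k (s - t) = iterate k s - iterate k t.
    exact: linear_mapB (iterate_linear k).
  rewrite (ll n.+1) (ll n) (iterate_commute n n.+1).
  rewrite subrKA -scalerBr; congr (_ *: _).
  by rewrite opprD addrACA subrr add0r.
rewrite nrmZ ger0_norm; last by rewrite invr_ge0.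
set d := _ - iterate n x.
have h1 := nrmD (iterate n.+1 d) (iterate n d).
have h2 := iterate_bound n.+1 d; have h3 := iterate_bound n d.
have h4 : (majorant n.+1 + majorant n) * nrm d <=
   (majorant n.+1 + majorant n) * ((majorant n.+1 - majorant n) * nrm x).
  have p0 : 0 <= majorant n.+1 + majorant n by rewrite addr_ge0 ?majorant_ge0.
  exact: ler_wpM2l p0 _ _ (h x).
have -> : majorant n.+2 = (1 + majorant n.+1 ^+ 2) / 2 by [].
have e : majorant n.+1 = (1 + majorant n ^+ 2) / 2 by [].
have e2 : (1 + majorant n.+1 ^+ 2) / 2 - majorant n.+1 =
  (majorant n.+1 + majorant n) * (majorant n.+1 - majorant n) / 2.
  by rewrite {2}e; field.
by rewrite e2; lra.
Qed.

Lemma iterate_dist n m x :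
  nrm (iterate n x - iterate m x) <=
    (1 - majorant n) * nrm x + (1 - majorant m) * nrm x.
Proof.
have mono k j : (k <= j)%N ->
    nrm (iterate j x - iterate k x) <= (majorant j - majorant k) * nrm x.
  move=> /subnK <-; elim: (j - k)%N => [|i h].
    by rewrite add0n !subrr nrm0 mul0r.
  rewrite addSn; apply: le_trans (nrm_tri _ (iterate (i + k) x) _) _.
  by have := iterate_step (i + k) x; lra.
have b k : 0 <= (1 - majorant k) * nrm x.
  by rewrite mulr_ge0 ?nrm_ge0 // subr_ge0 majorant_le1.
have [/mono h|/ltnW/mono h] := leqP n m.
  by rewrite nrmC; apply: le_trans h _; have := b m; have := b n; lra.
by apply: le_trans h _; have := b m; have := b n; lra.
Qed.

Lemma majorant_lim0 (C r : R) :
  0 <= r -> (forall n, r <= C * (1 - majorant n)) -> r = 0.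
Proof.
move=> r0 h; apply/eqP; rewrite eq_le r0 andbT.
have C0 : 0 <= C by have := h 0%N; rewrite subr0 mulr1; lra.
apply/ler_addgt0Pr => d d0; rewrite add0r.
have [|M /(_ M.+1 (leqnSn _)) HM] := @eventually_div_lt R ((C + 1) * 2) d _ d0.
  by lra.
have := h M; have := ler_wpM2l C0 (majorant_near1 M).
have : 0 <= 2 / M.+2%:R :> R by rewrite divr_ge0.
by move: HM; rewrite -mulrA; move: (2 / _) => t; lra.
Qed.

Lemma majorant_lim (C : R) x : (forall n, nrm x <= C * (1 - majorant n)) -> x = 0.
Proof. by move=> h; apply/nrm0_eq0/(majorant_lim0 (nrm_ge0 x) h). Qed.

(** Every property of the limit follows from that of the iterates, because each
    defect is bounded by a multiple of 1 - majorant n.  The clause on commuting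
    operators is what allows roots of different operators to be multiplied. *)
Lemma root_of_complement : exists Y : H -> H,
  [/\ contraction_sym Y,
      (forall x, (x - Y x) - Y (x - Y x) = x - N x) &
      forall C : H -> H, linear_map C ->
        (exists M, forall x, nrm (C x) <= M * nrm x) ->
        (forall x, C (N x) = N (C x)) -> forall x, C (Y x) = Y (C x)].
Proof.
have H0 x : exists l, forall n, nrm (iterate n x - l) <= (1 - majorant n) * nrm x.
  apply: complete_cvg_rate; first by move=> n m; exact: iterate_dist.
  move=> d d0.
  have [|M HM] := @eventually_div_lt R ((nrm x + 1) * 2) d _ d0.
    by have := nrm_ge0 x; lra.
  exists M => n /leqW/HM; rewrite -mulrA.
  have := ler_wpM2r (nrm_ge0 x) (majorant_near1 n).
  have : 0 <= 2 / n.+2%:R :> R by rewrite divr_ge0.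
  by move: (2 / _) => t; lra.
have [Y HY] := choice H0.
have b0 n : 0 <= 1 - majorant n by rewrite subr_ge0 majorant_le1.
have YL : linear_map Y.
  move=> a x y; apply/eqP; rewrite -subr_eq0; apply/eqP.
  apply: (@majorant_lim (nrm (a *: x + y) + complex.Re `|a| * nrm x + nrm y)) => n.
  have -> : Y (a *: x + y) - (a *: Y x + Y y) =
     - (iterate n (a *: x + y) - Y (a *: x + y)) +
     (a *: (iterate n x - Y x) + (iterate n y - Y y)).
    by rewrite iterate_linear scalerBr addrACA -opprD opprB subrKA.
  have a0 : 0 <= complex.Re `|a| by have := normr_ge0 a; rewrite lecE => /andP[].
  apply: le_trans (nrmD _ _) _; rewrite nrmN.
  have := nrmD (a *: (iterate n x - Y x)) (iterate n y - Y y).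
  rewrite nrmZC; have := HY y n; have := ler_wpM2l a0 (HY x n).
  by have := HY (a *: x + y) n; lra.
have Yb x : nrm (Y x) <= nrm x.
  have := HY x 0%N; rewrite /= sub0r nrmN; lra.
exists Y; split.
- split=> // x y; apply/eqP; rewrite -subr_eq0 -normr_eq0; apply/eqP.
  apply: (@majorant_lim0 (2 * (nrm x * nrm y))) => // n.
  have -> : rip (Y x) y - rip x (Y y) =
     rip x (iterate n y - Y y) - rip (iterate n x - Y x) y.
    by rewrite !ripE iterate_sym; ring.
  apply: le_trans (ler_normB _ _) _.
  have := cauchy_schwarz x (iterate n y - Y y).
  have := cauchy_schwarz (iterate n x - Y x) y.
  have := ler_wpM2l (nrm_ge0 x) (HY y n); have := ler_wpM2r (nrm_ge0 y) (HY x n).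
  lra.
- move=> x; rewrite linear_mapB //.
  have -> : x - Y x - (Y x - Y (Y x)) = x - (2%:R%:C *: Y x - Y (Y x)).
    rewrite [2%:R%:C](rmorphD (real_complex R) 1 1) scalerDl scale1r.
    by rewrite -addrA -opprD addrA.
  congr (x - _); apply/eqP; rewrite -subr_eq0; apply/eqP.
  apply: (@majorant_lim (4 * nrm x)) => n.
  have -> : 2%:R%:C *: Y x - Y (Y x) - N x =
     2%:R%:C *: (Y x - iterate n.+1 x) + (iterate n (iterate n x - Y x) +
      (iterate n (Y x) - Y (Y x))).
    rewrite (linear_mapB _ _ (iterate_linear n)) subrKA scalerBr /= scalerA.
    have -> : 2%:R%:C * (2^-1)%:C = 1 :> R[i].
      by rewrite -(rmorphM (real_complex R)) divff.
    rewrite scale1r opprD.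
    by rewrite -!addrA addKr [- N x + _]addrC.
  apply: le_trans (nrmD _ _) _; rewrite nrmZ nrmC ger0_norm //.
  have := nrmD (iterate n (iterate n x - Y x)) (iterate n (Y x) - Y (Y x)).
  have := HY (Y x) n; have := HY x n.+1; have := HY x n.
  have := iterate_bound n (iterate n x - Y x).
  have := majorantS n.
  have := ler_wpM2l (b0 n) (Yb x).
  have := ler_wpM2r (nrm_ge0 (iterate n x - Y x)) (majorant_le1 n).
  move: (majorant n.+1) (nrm_ge0 x) => r x0 h1 h2 h3 h4 h5 h6 h7 h8.
  have := ler_wpM2r x0 h3; lra.
- move=> C lC [M CM] CN x; apply/eqP; rewrite -subr_eq0; apply/eqP.
  have M0 : 0 <= `|M| by [].
  apply: (@majorant_lim (`|M| * nrm x + nrm (C x))) => n.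
  have -> : C (Y x) - Y (C x) =
     - C (iterate n x - Y x) + (iterate n (C x) - Y (C x)).
    by rewrite (linear_mapB _ _ lC) opprB (iterate_comm n lC CN) subrKA.
  apply: le_trans (nrmD _ _) _; rewrite nrmN.
  have := ler_wpM2l M0 (HY x n); have := CM (iterate n x - Y x).
  have := ler_wpM2r (nrm_ge0 (iterate n x - Y x)) (ler_norm M).
  by have := HY (C x) n; lra.
Qed.

End BoundedRoot.

(** * Square roots of unbounded operators *)

Section UnboundedRoot.
Context {R : realType}.
Variable H : hilbertType R.
Implicit Types (x y z : H).

(** The relation x + D x |-> x is closed and contractive, so its domain is all of H
    as soon as it is dense; and a vector z orthogonal to it satisfies D z = - z,
    which forces z = 0. *)
Lemma range_id_add (D : set (H * H)) : nonneg_selfadjoint D ->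
  forall h, exists x, D (x, h - x).
Proof.
move=> nD; have sD := nD.1; have [lD dD eD] := sD; have oD := op_subspace lD.
pose S : set (H * H) := [set p | D (p.2, p.1 - p.2)].
have oS : is_subspace S.
  split; first by rewrite /S /= subrr; case: lD.
  move=> a [h x] [h' x'] /= k k'.
  have := oD.2 a _ _ k k'; congr D; congr pair.
  by rewrite /= scalerBr addrACA -opprD.
have Sb (h x : H) : S (h, x) -> nrm x <= nrm h.
  move=> /(nonneg_rip nD) /=; rewrite !ripE => h0.
  by apply: le_nrm_rip; have := cauchy_schwarz h x; have := rip_ge0 (h - x);
     rewrite !ripE (ripC x h) => h1 _; lra.
suff dS : dom S = setT.
  by move=> h; have : dom S h by rewrite dS.
apply: (@closed_bounded_dom _ _ _ S 1) => //; last first.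
  by move=> x y /Sb; rewrite mul1r.
split.
- apply: subspace_op => // y /Sb; rewrite nrm0 => h.
  by apply: nrm0_eq0; apply/eqP; rewrite eq_le h nrm_ge0.
- apply/closure_id/seteqP; split; first exact: subset_closure.
  move=> [h x] /closure_pairP cl.
  rewrite /S /= (closure_id D).1; last exact: selfadjoint_closed.
  apply/closure_pairP => e e0; have [|h' [x' [Sh eh ex]]] := cl (e / 2).
    exact: divr_gt0.
  exists x', (h' - x'); split; [exact: Sh|lra|].
  have -> : h - x - (h' - x') = (h - h') - (x - x').
    by rewrite [in LHS]opprD addrACA -opprD.
  apply: le_lt_trans (nrmD _ _) _; rewrite nrmN; lra.
- apply: dense_orth; first exact: dom_subspace.
  move=> z hz; have Dz : D (z, - z).
    rewrite eD; apply/(adjoint_rip _ _ oD) => u v h.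
    have /hz : dom S (u + v) by exists u; rewrite /S /= addrC addKr.
    by rewrite !ripE; lra.
  have := nonneg_rip nD Dz; rewrite ripNl => h; apply: rip_eq0.
  by have := rip_ge0 z; lra.
Qed.

(** Let A = (1 + D)^-1 and N = 1 - A, so that D is the operator A t |-> N t.  With
    commuting roots P of A and Q of N, the operator P u |-> Q u is the root.  It
    is selfadjoint because P^2 + Q^2 = 1 lets one solve P u = z, Q u = w, by
    u = P z + Q w, whenever Q z = P w.  It is nonnegative because P is itself a
    square V^2 with V commuting with Q, so that (Q u, P u) = (Q V u, V u). *)
Lemma op_sqrt_exists (D : set (H * H)) : nonneg_selfadjoint D ->
  exists S, is_op_sqrt S D.
Proof.
move=> nD; have sD := nD.1; have [lD dD eD] := sD; have oD := op_subspace lD.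
have [A DA'] := choice (range_id_add nD).
have [N NE] : exists N, forall x, N x = x - A x by exists (fun x => x - A x).
have DA x : D (A x, N x) by rewrite NE.
(* The kernel of 1 + D is trivial. *)
have inj x y : D (x, y) -> A (x + y) = x.
  move=> h; have := subspaceB oD (DA (x + y)) h => k.
  have {}k : D (A (x + y) - x, - (A (x + y) - x)).
    move: k; rewrite NE; congr D; congr pair.
    rewrite /= -addrA -opprD (addrC (A _)) [x + y]addrC opprD addrACA subrr.
    by rewrite add0r opprB.
  apply/eqP; rewrite -subr_eq0; apply/eqP/rip_eq0.
  have := nonneg_rip nD k; rewrite ripNl; have := rip_ge0 (A (x + y) - x); lra.
have An x : A x + N x = x by rewrite NE addrC subrK.
have lA : linear_map A.
  move=> a x y; have := oD.2 a _ _ (DA x) (DA y) => /inj.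
  by rewrite /= addrACA -scalerDr !An.
have symA x y : rip (A x) y = rip x (A y).
  have e : rip (N x) (A y) = rip (A x) (N y).
    exact: selfadjoint_rip sD _ _ _ _ (DA x) (DA y).
  by rewrite -{1}(An y) -{2}(An x) ripDr ripDl e.
have pos x : 0 <= rip (N x) (A x) := nonneg_rip nD (DA x).
have sq x : rip x x = rip (A x) (A x) + rip (N x) (N x) + 2 * rip (N x) (A x).
  have : rip (A x + N x) (A x + N x) = rip x x by rewrite An.
  by rewrite !ripE (ripC (A x) (N x)); lra.
have cA : contraction_sym A.
  split=> // x; apply: le_nrm_rip.
  by have := sq x; have := pos x; have := rip_ge0 (N x); lra.
have cN : contraction_sym N.
  split.
  - by move=> a x y; rewrite !NE lA scalerBr addrACA -opprD.
  - move=> x; apply: le_nrm_rip.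
    by have := sq x; have := pos x; have := rip_ge0 (A x); lra.
  - by move=> x y; rewrite !NE; exact: complement_sym.
have AN x : A (N x) = N (A x) by rewrite !NE (linear_mapB _ _ lA).
have bdd f : contraction_sym f -> exists M, forall x, nrm (f x) <= M * nrm x.
  by move=> [_ h _]; exists 1 => x; rewrite mul1r.
have lin (f : H -> H) : contraction_sym f -> linear_map f by case.
(* The roots are 1 - Y of A, 1 - Z of N, and 1 - W of 1 - Y. *)
have [Y [cY Y2 YC]] := root_of_complement cN.
have [Z [cZ Z2 ZC]] := root_of_complement cA.
have [W [cW W2 WC]] := root_of_complement cY.
have AY : forall x, A (Y x) = Y (A x) by apply: YC => //; exact: bdd.
have YZ : forall x, Y (Z x) = Z (Y x).
  by apply: ZC => [||x]; [exact: lin|exact: bdd|rewrite AY].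
have ZW : forall x, Z (W x) = W (Z x).
  by apply: WC => [||x]; [exact: lin|exact: bdd|rewrite YZ].
pose P x := x - Y x; pose Q x := x - Z x; pose V x := x - W x.
have PP x : P (P x) = A x by rewrite /P Y2 NE opprB addrC subrK.
have QQ x : Q (Q x) = N x by rewrite /Q Z2 NE.
have VV x : V (V x) = P x by rewrite /V W2.
have lP : linear_map P.
  by move=> a x y; rewrite /P (lin _ cY) scalerBr addrACA -opprD.
have lQ : linear_map Q.
  by move=> a x y; rewrite /Q (lin _ cZ) scalerBr addrACA -opprD.
have PQ x : P (Q x) = Q (P x).
  rewrite /P /Q (linear_mapB _ _ (lin _ cY)) (linear_mapB _ _ (lin _ cZ)) YZ.
  by rewrite [in LHS]opprD addrACA -opprD.
have VQ x : V (Q x) = Q (V x).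
  rewrite /V /Q (linear_mapB _ _ (lin _ cW)) (linear_mapB _ _ (lin _ cZ)) ZW.
  by rewrite [in LHS]opprD addrACA -opprD.
have sP x y : rip (P x) y = rip x (P y) := complement_sym cY x y.
have sQ x y : rip (Q x) y = rip x (Q y) := complement_sym cZ x y.
have sV x y : rip (V x) y = rip x (V y) := complement_sym cW x y.
have pQ x : 0 <= rip (Q x) x.
  by rewrite /Q !ripE subr_ge0; exact: rip_contraction_le.
pose S : set (H * H) := [set p | exists u, p = (P u, Q u)].
have oS : is_subspace S.
  split; first by exists 0; rewrite !linear_map0.
  by move=> a _ _ [u ->] [v ->]; exists (a *: u + v); rewrite lP lQ.
have P0 u : P u = 0 -> u = 0.
  move=> e; have A0 : A u = 0 by rewrite -PP e linear_map0.
  have := DA u; rewrite NE A0 subr0 => h.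
  exact: op_fun lD h oD.1.
(* P^2 + Q^2 = 1 and P Q = Q P. *)
have invP z w : Q z = P w -> P (P z + Q w) = z.
  by move=> e; rewrite (linear_mapD _ _ lP) PP PQ -e QQ An.
have invQ z w : Q z = P w -> Q (P z + Q w) = w.
  by move=> e; rewrite (linear_mapD _ _ lQ) -PQ e PP QQ An.
exists S; split.
- apply: nonneg_selfadjointP; last first.
    by move=> _ _ [u [-> ->]]; rewrite -VV -sV VQ.
  split.
  + apply: subspace_op => // y [u [/esym/P0 -> ->]]; exact: linear_map0.
  + apply: dense_orth; first exact: dom_subspace.
    move=> z hz; apply/P0/rip_inj => u; rewrite -sP rip0r hz //.
    by exists (Q u), u.
  + apply/seteqP; split.
      move=> _ [u ->]; apply/(adjoint_rip _ _ oS) => _ _ [v [-> ->]].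
      by rewrite sQ -PQ -sP.
    move=> [z w] /(adjoint_rip _ _ oS) h.
    have e : Q z = P w.
      by apply: rip_inj => u; rewrite -sP -sQ; apply: h; exists u.
    by exists (P z + Q w); rewrite invP ?invQ.
- apply/seteqP; split.
    move=> [x y] [_ [[u [-> ->]] [v [/= e ->]]]].
    have eP : A (P u + Q v) = P u by rewrite -PP (invP _ _ e).
    have eQ : N (P u + Q v) = Q v by rewrite -QQ (invQ _ _ e).
    by have := DA (P u + Q v); rewrite eP eQ.
  move=> [x y] /inj e.
  have ey : N (x + y) = y by rewrite NE e addrC addKr.
  exists (Q (P (x + y))); split; first by exists (P (x + y)); rewrite PP e.
  by exists (Q (x + y)); rewrite QQ ey PQ.
Qed.

End UnboundedRoot.

(** * The order of nonnegative selfadjoint operators *)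

Section Order.
Context {R : realType}.
Implicit Types H K : hilbertType R.

(** On the domain of T^* T both |C x|^2 and |T x|^2 are equal to (x, T^* T x), and
    this domain is a core of C as well as of T.  Here the core of C is used, and
    in [dom_sub_sqrt] that of T. *)
Lemma dom_sqrt_sub H K (T : set (H * K)) (C : set (H * H)) :
  closed_densely_defined T -> is_op_sqrt C (op_prod (adjoint T) T) ->
  forall x y, C (x, y) -> exists z, T (x, z) /\ nrm z <= nrm y.
Proof.
move=> cT [nC eC] x y; have [sC _] := nC; have cC := selfadjoint_cdd sC.
have [lT _ _] := cT; have sT := op_subspace lT; have [lC _ aC] := sC.
suff : forall x z, C (x, z) -> exists y, T (x, y) /\ nrm y <= 1 * nrm z.
  by move=> h /h; rewrite mul1r.
apply: dominated_on_core => // {}x {}y Cxy.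
rewrite -aC eC => -[w [z [/= Txz /(adjoint_rip _ _ sT) h]]].
exists z; split=> //; rewrite mul1r; apply: le_nrm_rip; rewrite (h _ _ Txz).
have : op_prod C C (x, w).
  by rewrite eC; exists z; split=> //; apply/(adjoint_rip _ _ sT).
move=> [y' [/= h1 h2]]; rewrite (op_fun lC Cxy h1).
by rewrite (selfadjoint_rip sC h1 h2).
Qed.

Lemma dom_sub_sqrt H K (T : set (H * K)) (C : set (H * H)) :
  closed_densely_defined T -> is_op_sqrt C (op_prod (adjoint T) T) ->
  forall x z, T (x, z) -> exists y, C (x, y) /\ nrm y <= nrm z.
Proof.
move=> cT [nC eC] x z; have [sC _] := nC; have cC := selfadjoint_cdd sC.
have [lT _ _] := cT; have sT := op_subspace lT.
suff : forall x z, T (x, z) -> exists y, C (x, y) /\ nrm y <= 1 * nrm z.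
  by move=> h /h; rewrite mul1r.
apply: dominated_on_core => // {}x {}z Txz.
rewrite -eC => -[w [y [/= h1 h2]]].
exists y; split=> //; rewrite mul1r; apply: le_nrm_rip.
rewrite (selfadjoint_rip sC h1 h2).
have : op_prod (adjoint T) T (x, w) by rewrite -eC; exists y.
move=> [z' [/= h3 /(adjoint_rip _ _ sT) h4]]; rewrite (op_fun lT Txz h3).
by rewrite -(h4 _ _ h3).
Qed.

Lemma nrm_sqrt H K (T : set (H * K)) (C : set (H * H)) :
  closed_densely_defined T -> is_op_sqrt C (op_prod (adjoint T) T) ->
  forall x y z, C (x, y) -> T (x, z) -> nrm z = nrm y.
Proof.
move=> cT rC x y z Cxy Txz.
have [lC _ _] := selfadjoint_cdd rC.1.1; have [lT _ _] := cT.
have [z' [/(op_fun lT Txz) <- h1]] := dom_sqrt_sub cT rC Cxy.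
have [y' [/(op_fun lC Cxy) <- h2]] := dom_sub_sqrt cT rC Txz.
by apply/eqP; rewrite eq_le h1 h2.
Qed.

(** It is enough to compare the forms on the domain of D, because that domain is a
    core of the root of D. *)
Lemma op_le_of_form_bound H K (T : set (H * K)) (D : set (H * H)) (lambda : R) :
  closed_densely_defined T -> nonneg_selfadjoint D -> 0 <= lambda ->
  (forall x w, D (x, w) -> exists z, T (x, z) /\ rip z z <= lambda * rip x w) ->
  op_le (op_prod (adjoint T) T) lambda D.
Proof.
move=> cT nD l0 h; have nT := (vonNeumann cT).2.
have [C rC] := op_sqrt_exists nT; have [D2 rD] := op_sqrt_exists nD.
have [nD2 eD] := rD; have sD2 := nD2.1; have cD2 := selfadjoint_cdd sD2.
have key : forall x v, D2 (x, v) ->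
    exists z, T (x, z) /\ nrm z <= Num.sqrt lambda * nrm v.
  apply: dominated_on_core => //.
  have [lD2 _ aD] := sD2; rewrite -aD eD => x v Dxv [w Dxw].
  have [z [Txz hz]] := h _ _ Dxw; exists z; split=> //.
  rewrite -(ler_pXn2r (n := 2)) ?nnegrE ?mulr_ge0 ?nrm_ge0 ?sqrtr_ge0 //.
  rewrite exprMn sqr_sqrtr // !sqr_nrm; apply: le_trans hz _.
  move: Dxw; rewrite -eD => -[v' [/= h1 h2]].
  by rewrite (op_fun lD2 Dxv h1) (selfadjoint_rip sD2 h1 h2).
split=> //; exists C, D2; split=> //.
  move=> x [v /key [z [Txz _]]].
  by have [y [Cxy _]] := dom_sub_sqrt cT rC Txz; exists y.
move=> x y v Cxy /key [z [Txz hz]].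
by rewrite !nrmE -rmorphM lecR -(nrm_sqrt cT rC Cxy Txz).
Qed.

(** The supremum in the definition runs over the unit ball; rescale x into it. *)
Lemma opnormP H (X : set (H * H)) : Bplus X ->
  0 <= opnorm X /\ forall x y, X (x, y) -> nrm y <= opnorm X * nrm x.
Proof.
move=> [[[lX _ _] _] _ [M XM]]; have sX := op_subspace lX.
set E := [set r | exists x y, [/\ X (x, y), `|x| <= 1 & r = complex.Re `|y|]].
have E0 : E 0 by exists 0, 0; split; rewrite ?normr0 //; exact: sX.1.
have ub : has_ubound E.
  exists `|M| => r [x [y [/XM h x1 ->]]].
  move: h x1; rewrite !nrmE -rmorphM !lecR => h x1; apply: le_trans h _.
  apply: le_trans (ler_wpM2r (nrm_ge0 x) (ler_norm M)) _.
  by rewrite ler_piMr.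
have hs : has_sup E by split=> //; exists 0.
have o0 : 0 <= opnorm X := @sup_upper_bound _ _ hs _ E0.
split=> // x y Xxy.
have [x0|x0] := eqVneq (nrm x) 0.
  by have := XM _ _ Xxy; rewrite !nrmE -rmorphM lecR x0 !mulr0.
have xp : 0 < nrm x by rewrite lt_def x0 nrm_ge0.
have : E (nrm ((nrm x)^-1%:C *: y)).
  exists ((nrm x)^-1%:C *: x), ((nrm x)^-1%:C *: y); split=> //.
    exact: subspaceZ _ sX Xxy.
  rewrite nrmE nrmZ lecR ger0_norm ?invr_ge0 ?nrm_ge0 //.
  by rewrite mulVf.
move=> /(sup_upper_bound hs).
by rewrite nrmZ ger0_norm ?invr_ge0 ?nrm_ge0 // mulrC ler_pdivrMr.
Qed.

Lemma opnorm_le H (X : set (H * H)) (M : R) : is_linear_operator X -> 0 <= M ->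
  (forall x y, X (x, y) -> nrm y <= M * nrm x) -> opnorm X <= M.
Proof.
move=> lX M0 XM; have sX := op_subspace lX.
apply: ge_sup; first by exists 0, 0, 0; split; rewrite ?normr0 //; exact: sX.1.
move=> r [x [y [/XM h x1 ->]]]; apply: le_trans h _.
by move: x1; rewrite nrmE lecR => x1; rewrite ler_piMr.
Qed.

(** Let m be the norm of X and w = X z.  Nonnegativity of X at m z - w reads
    m^2 (w, z) - 2 m |w|^2 + (X w, w) >= 0, while (X w, w) <= m |w|^2. *)
Lemma Bplus_sqr_le H (X : set (H * H)) : Bplus X ->
  forall z w, X (z, w) -> rip w w <= opnorm X * rip w z.
Proof.
move=> bX z w Xzw; have [m0 Xm] := opnormP bX; have [nX dX _] := bX.
have [sX _] := nX; have [lX _ _] := sX; have oX := op_subspace lX.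
have [v Xwv] : dom X w by rewrite dX.
have a0 : 0 <= rip v w := nonneg_rip nX Xwv.
have b0 : 0 <= rip w z := nonneg_rip nX Xzw.
have cw : rip v w <= opnorm X * rip w w.
  apply: le_trans (rip_le_nrm _ _) _; rewrite -sqr_nrm expr2 mulrA.
  by rewrite ler_wpM2r ?nrm_ge0 //; exact: Xm.
have sym : rip v z = rip w w := selfadjoint_rip sX Xwv Xzw.
set m := opnorm X in m0 cw *; set c := rip w w in cw sym *.
have [->|mn] := eqVneq c 0; first by rewrite mulr_ge0.
have c0 : 0 < c by rewrite lt_def mn rip_ge0.
have mp : 0 < m.
  rewrite lt_def m0 andbT; apply/eqP => e; rewrite e mul0r in cw.
  have h := Xm _ _ Xzw; rewrite -/m e mul0r in h.
  have w0 : nrm w = 0 by apply/eqP; rewrite eq_le h nrm_ge0.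
  by move: mn; rewrite /c -sqr_nrm w0 expr0n eqxx.
have h := nonneg_rip nX (subspaceB oX (subspaceZ m%:C oX Xzw) Xwv).
move: h; rewrite /= !ripE -/c sym => h.
have e : m * (m * rip w z - c) >= 0 by lra.
by move: e; rewrite pmulr_rge0 // subr_ge0.
Qed.

End Order.

(** * Construction of a nonnegative factor *)

Section Factor.
Context {R : realType}.
Implicit Types H K : hilbertType R.

Lemma closure_bound H K (A : set (H * K)) (M : R) : 0 <= M ->
  (forall x y, A (x, y) -> nrm y <= M * nrm x) ->
  forall x y, closure A (x, y) -> nrm y <= M * nrm x.
Proof.
move=> M0 AM x y /closure_pairP cl; apply/ler_addgt0Pr => d d0.
have [|x' [y' [/AM h hx hy]]] := cl (d / (M + 1)).
  by apply: divr_gt0 => //; lra.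
have := nrm_tri y y' 0; have := nrm_tri x' x 0; rewrite !subr0 (nrmC x').
move=> k1 k2; have := ler_wpM2l M0 k1; have := ler_wpM2l M0 (ltW hx).
by have : d / (M + 1) * (M + 1) = d by [rewrite divfK // gt_eqF //; lra]; lra.
Qed.

(** The inclusion that is not formal holds since the closed biadjoint contains A. *)
Lemma adjoint_closure H K (A : set (H * K)) : is_subspace A ->
  adjoint (closure A) = adjoint A.
Proof.
move=> sA; have sAA := adjoint_subspace A.
have sc := subspace_closure sA.
apply/seteqP; split; first exact/adjointS/subset_closure.
have cl : closure A `<=` adjoint (adjoint A).
  apply: closed_closure_sub; first exact/adjoint_closed/adjoint_subspace.
  move=> [u v] h; apply/(adjoint_rip _ _ sAA) => x y /(adjoint_rip _ _ sA) h'.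
  by rewrite ripC -(h' _ _ h) ripC.
move=> [x y] h; apply/(adjoint_rip _ _ sc) => u v /cl /(adjoint_rip _ _ sAA) h'.
by rewrite ripC -(h' _ _ h) ripC.
Qed.

(** If (x_n, b_n) in B converges to (x, b), then X b_n converges to X b because X
    is bounded, and T is closed. *)
Lemma factor_closure H K (T B : set (H * K)) (X : set (K * K)) :
  closed_densely_defined T -> is_subspace B -> Bplus X ->
  op_prod X B `<=` T -> op_prod X (closure B) `<=` T.
Proof.
move=> [lT cT _] sB bX XB [x y] [b [/= cxb Xby]].
have [m0 Xm] := opnormP bX; have [[[lX _ _] _] dX _] := bX.
have [sX _ _] := bX; have cX := selfadjoint_closed sX.1.
have oX := op_subspace lX.
pose W : set ((H * K) * K) := [set p | B p.1 /\ X (p.1.2, p.2)].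
have [||||z cz] := @closure_lift R (H * K)%type K W (opnorm X) (x, b).
- split; first by split; [case: sB|case: oX].
  move=> a p q [h1 h2] [h3 h4]; split; first exact: sB.2.
  exact: oX.2 a _ _ h2 h4.
- exact: m0.
- move=> p z [_ /= /Xm h]; apply: le_trans h _; rewrite ler_wpM2l //.
  exact: (nrm_snd p).
- apply: closureS cxb => -[u v] /= h.
  have [z Xz] : dom X v by rewrite dX.
  by exists z.
have near e : 0 < e -> exists u v w, [/\ B (u, v), X (v, w), nrm (x - u) < e,
    nrm (b - v) < e & nrm (z - w) < e].
  move=> e0; have [[u v] [w [[/= h1 h2] h3 h4]]] := (closure_pairP _ _ _).1 cz e e0.
  exists u, v, w; split=> //; apply: le_lt_trans h3.
    exact: (nrm_fst (x - u, b - v)).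
  exact: (nrm_snd (x - u, b - v)).
have Xbz : X (b, z).
  rewrite (closure_id X).1 //; apply/closure_pairP => e /near.
  by move=> [u [v [w [_ h _ h1 h2]]]]; exists v, w.
rewrite (op_fun lX Xby Xbz) (closure_id T).1 //; apply/closure_pairP => e /near.
move=> [u [v [w [h1 h2 h3 _ h4]]]]; exists u, w; split=> //; apply: XB.
by exists v.
Qed.

(** With J the closure of J0, the factor X = J J^* is written as S^* S for
    S = J^*, so that [vonNeumann] applies to it. *)
Lemma factor_exists H K (T B0 : set (H * K)) (D : set (H * H)) (lambda : R) :
  closed_densely_defined T -> 0 <= lambda ->
  op_le (op_prod (adjoint T) T) lambda D ->
  (forall x b, B0 (x, b) -> exists w, D (x, w) /\ adjoint T (b, w)) ->
  exists X : set (K * K),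
    [/\ Bplus X, op_prod X B0 `<=` T, ker (adjoint T) `<=` ker X &
        opnorm X <= lambda].
Proof.
move=> cT l0 [nT nD [C2 [D2 [rC rD domD CD]]]] B0D.
have [lT clT _] := cT; have sT := op_subspace lT.
have [nD2 eD] := rD; have sD2 := nD2.1; have [lD2 _ _] := sD2.
have oD2 := op_subspace lD2.
set s := Num.sqrt lambda in CD; have s0 : 0 <= s by exact: sqrtr_ge0.
have TD u v : D2 (u, v) -> exists z, T (u, z) /\ nrm z <= s * nrm v.
  move=> h; have [y Cy] : dom C2 u by apply: domD; exists v.
  have [z [Tz hz]] := dom_sqrt_sub cT rC Cy; exists z; split=> //.
  apply: le_trans hz _; have := CD _ _ _ Cy h.
  by rewrite !nrmE -rmorphM lecR.
(* The complement w is added so that J0 is densely defined. *)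
pose orth w := forall u v, D2 (u, v) -> rip v w = 0.
pose J0 : set (H * K) := [set p | exists u v w,
  [/\ p.1 = v + w, D2 (u, v), T (u, p.2) & orth w]].
have orth0 : orth 0 by move=> u v _; rewrite rip0r.
have sJ0 : is_subspace J0.
  split.
    by exists 0, 0, 0; split; rewrite ?addr0 //; [exact: oD2.1|exact: sT.1].
  move=> a p p' [u [v [w [e h1 h2 h3]]]] [u' [v' [w' [e' h1' h2' h3']]]].
  exists (a *: u + u'), (a *: v + v'), (a *: w + w'); split.
  - by rewrite /= e e' scalerDr addrACA.
  - exact: oD2.2 a _ _ h1 h1'.
  - exact: sT.2 a _ _ h2 h2'.
  - move=> c d hD; rewrite ripDr rip_conjZ (h3' _ _ hD) addr0.
    exact: h3 (subspaceZ a^* oD2 hD).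
have bJ0 x y : J0 (x, y) -> nrm y <= s * nrm x.
  move=> [u [v [w [/= -> h1 h2 h3]]]].
  have [z [/(op_fun lT h2) <- hz]] := TD _ _ h1.
  apply: le_trans hz _; rewrite ler_wpM2l //; apply: le_nrm_rip.
  by rewrite !ripE (ripC w) (h3 _ _ h1); have := rip_ge0 w; lra.
have dJ0 : dense (dom J0).
  apply: dense_orth; first exact: dom_subspace.
  move=> z hz; apply: rip_eq0; apply: (hz z).
  exists 0, 0, 0, z; split; rewrite ?add0r //; [exact: oD2.1|exact: sT.1|].
  move=> u v h; apply: (hz v); have [y [Ty _]] := TD _ _ h.
  by exists y, u, v, 0; rewrite addr0.
pose J := closure J0.
have bJ := closure_bound s0 bJ0.
have cJ : closed_densely_defined J.
  split.
  - apply: subspace_op; first exact: subspace_closure.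
    move=> y /bJ; rewrite nrm0 mulr0 => h.
    by apply: nrm0_eq0; apply/eqP; rewrite eq_le h nrm_ge0.
  - exact: closed_closure.
  - apply/denseP => x; apply: closureS ((denseP _).1 dJ0 x) => u [v h].
    by exists v; exact: subset_closure.
have [lJ clJ dJ] := cJ; have sJ := op_subspace lJ.
pose S := adjoint J.
have eS : S = adjoint J0 := adjoint_closure sJ0.
have cS : closed_densely_defined S := adjoint_cdd cJ.
have bS : forall x y, S (x, y) -> nrm y <= s * nrm x := adjoint_bounded dJ s0 bJ.
have eSS : adjoint S = J := biadjoint sJ clJ.
have domS := closed_bounded_dom cS s0 bS.
have domJ := closed_bounded_dom cJ s0 bJ.
pose X := op_prod (adjoint S) S.
have [_ nX] := vonNeumann cS; have [[lX _ _] _] := nX.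
have bX x y : X (x, y) -> nrm y <= lambda * nrm x.
  move=> [z [/= /bS h1]]; rewrite eSS => /bJ h2; apply: le_trans h2 _.
  by rewrite -(sqr_sqrtr l0) expr2 -mulrA ler_wpM2l.
exists X; split.
- split=> //.
    apply/seteqP; split=> // x _; have [y Sy] : dom S x by rewrite domS.
    have [z Jz] : dom J y by rewrite domJ.
    by exists z, y; rewrite eSS.
  by exists lambda => x y /bX; rewrite !nrmE -rmorphM lecR.
- move=> [x y] [b [/= /B0D[w [Dxw /(adjoint_rip _ _ sT) Tbw]] Xby]].
  move: Dxw; rewrite -eD => -[v [/= h1 h2]].
  have [z [Tz _]] := TD _ _ h1.
  have : X (b, z).
    exists v; split=> /=.
      (* S b = sqrt D x: the pairing (T u', b) = (u', D x) is (v', sqrt D x). *)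
      rewrite eS; apply/(adjoint_rip _ _ sJ0) => p q [u' [v' [w' [/= -> k1 k2 k3]]]].
      rewrite (Tbw _ _ k2) ripDl (ripC w') (k3 _ _ h1) addr0.
      by rewrite (selfadjoint_rip sD2 k1 h2).
    rewrite eSS; apply: subset_closure; exists x, v, 0.
    by rewrite addr0.
  by move=> /(op_fun lX Xby) ->.
- move=> z /(adjoint_rip _ _ sT) h; exists 0; split=> /=.
    rewrite eS; apply/(adjoint_rip _ _ sJ0) => p q [u' [v' [w' [/= _ _ k2 _]]]].
    by rewrite (h _ _ k2) !rip0r.
  by rewrite eSS; exact: sJ.1.
- exact: opnorm_le.
Qed.

End Factor.

(** * The equivalence of order and factorization *)

Theorem theorem2p7 (R : realType) (H K : hilbertType R) (T B : set (H * K)) :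
  closed_densely_defined T ->
  closed_densely_defined B ->
  selfadjoint (op_prod (adjoint T) B) ->
  let B0 := op_restrict B (dom (op_prod (adjoint T) B)) in
  let clB0 := closure B0 in
  let TT := op_prod (adjoint T) T in
  let TB := op_prod (adjoint T) B in
  let TclB0 := op_prod (adjoint T) clB0 in
  [/\ (* (i) <-> (ii) *)
      ((exists lambda : R, 0 <= lambda /\ op_le TT lambda TB) <->
       (exists X : set (K * K), Bplus X /\ op_prod X clB0 `<=` T)),
      (* for X as in (ii), lambda = ||X|| works in (i), and the identities hold *)
      (forall X : set (K * K), Bplus X -> op_prod X clB0 `<=` T ->
         [/\ op_le TT (opnorm X) TB,
             op_prod (adjoint B0) (op_prod X clB0) = TclB0 &
             TclB0 = op_prod (adjoint B0) T]),
      (* choice of X *)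
      (forall lambda : R, 0 <= lambda -> op_le TT lambda TB ->
         exists X : set (K * K),
           [/\ Bplus X, op_prod X clB0 `<=` T,
               ker (adjoint T) `<=` ker X & opnorm X <= lambda]),
      (* the case of equality *)
      ((exists lambda : R, 0 <= lambda /\ op_le TT lambda TclB0) /\
       dom T `<=` dom clB0 <->
       (exists X : set (K * K), Bplus X /\ T = op_prod X clB0)) &
      (* in that case, a solution X chosen as above has ker X = ker T^* *)
      ((exists X : set (K * K), Bplus X /\ T = op_prod X clB0) ->
       (exists X : set (K * K),
          [/\ Bplus X, T = op_prod X clB0 & ker X = ker (adjoint T)]) /\
       (forall X : set (K * K),
          Bplus X -> T = op_prod X clB0 -> ker (adjoint T) `<=` ker X ->
          ker X = ker (adjoint T)))].
Proof.
move=> cT cB sTB B0 clB0 TT TB TclB0.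
have [lT clT _] := cT; have sT := op_subspace lT.
have [lB _ _] := cB; have sB := op_subspace lB.
have [lTB _ aTB] := sTB; have oTB := op_subspace lTB.
have sB0 : is_subspace B0 by apply: restrict_subspace => //; exact: dom_subspace.
have B0cl : B0 `<=` clB0 := @subset_closure _ _.
have TBP x w : TB (x, w) ->
    exists b, [/\ B0 (x, b), clB0 (x, b) & adjoint T (b, w)].
  move=> h; have [b [/= Bxb Tbw]] := h; exists b.
  have B0xb : B0 (x, b) by split=> //; exists w.
  by split=> //; exact: B0cl.
have TBsub : TB `<=` TclB0.
  by move=> [x w] /TBP[b [_ h1 h2]]; exists b.
have B0D x b : B0 (x, b) -> exists w, TB (x, w) /\ adjoint T (b, w).
  move=> [[w [b' [/= h1 h2]]] /= h3]; exists w.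
  by rewrite (op_fun lB h3 h1); split=> //; exists b'.
have ii_i X : Bplus X -> op_prod X clB0 `<=` T ->
   [/\ op_le TT (opnorm X) TB,
       op_prod (adjoint B0) (op_prod X clB0) = TclB0,
       TclB0 = op_prod (adjoint B0) T & TclB0 = TB].
  move=> bX XT; have [m0 _] := opnormP bX; have [nX dX _] := bX.
  have [sX _] := nX; have [lX _ _] := sX.
  (* (x, D x) = (T x, B x) with T x = X B x. *)
  have step x w b : adjoint T (b, w) -> clB0 (x, b) ->
      exists y, [/\ X (b, y), T (x, y) & rip x w = rip y b].
    move=> /(adjoint_rip _ _ sT) Tbw Cxb; have [y Xby] : dom X b by rewrite dX.
    have Txy : T (x, y) by apply: XT; exists b.
    by exists y; rewrite (Tbw _ _ Txy).
  (* Taking adjoints in X B_0 \subseteq T. *)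
  have TaB : adjoint T `<=` op_prod (adjoint B0) X.
    move=> [z w] /(adjoint_rip _ _ sT) h; have [y Xzy] : dom X z by rewrite dX.
    exists y; split=> //; apply/(adjoint_rip _ _ sB0) => u v Buv.
    have [t Xvt] : dom X v by rewrite dX.
    have Tut : T (u, t) by apply: XT; exists v; split=> //; exact: B0cl.
    by rewrite -(h _ _ Tut) (selfadjoint_rip sX Xvt Xzy).
  (* B_0^* T is contained in the adjoint of T^* B, which is T^* B. *)
  have BaT : op_prod (adjoint B0) T `<=` TB.
    move=> [x w] [y [/= Txy /(adjoint_rip _ _ sB0) h]].
    suff : adjoint TB (x, w) by rewrite /TB -aTB.
    apply/(adjoint_rip _ _ oTB) => u v /TBP[b [Bub _]].
    move=> /(adjoint_rip _ _ sT) h'.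
    by rewrite -(h _ _ Bub) ripC -(h' _ _ Txy) ripC.
  have c1 : TclB0 `<=` op_prod (adjoint B0) (op_prod X clB0).
    move=> [x w] [b [/= Cxb /TaB[y [/= Xby h]]]].
    by exists y; split=> //; exists b.
  have c2 : op_prod (adjoint B0) (op_prod X clB0) `<=` op_prod (adjoint B0) T.
    by move=> [x w] [y [/= /XT h1 h2]]; exists y.
  split.
  - apply: op_le_of_form_bound => //.
      apply: nonneg_selfadjointP => // x w /TBP[b [_ Cxb Tbw]].
      have [y [Xby _ e]] := step _ _ _ Tbw Cxb.
      by rewrite ripC e (nonneg_rip nX Xby).
    move=> x w /TBP[b [_ Cxb Tbw]]; have [y [Xby Txy e]] := step _ _ _ Tbw Cxb.
    by exists y; split=> //; rewrite e; exact: Bplus_sqr_le.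
  - apply/seteqP; split=> //.
    exact: subset_trans c2 (subset_trans BaT TBsub).
  - apply/seteqP; split; first exact: subset_trans c1 c2.
    exact: subset_trans BaT TBsub.
  - apply/seteqP; split=> //.
    exact: subset_trans c1 (subset_trans c2 BaT).
have i_ii lambda : 0 <= lambda -> op_le TT lambda TB ->
    exists X : set (K * K), [/\ Bplus X, op_prod X clB0 `<=` T,
      ker (adjoint T) `<=` ker X & opnorm X <= lambda].
  move=> l0 h; have [X [bX XT kX nX]] := factor_exists cT l0 h B0D.
  by exists X; split=> //; exact: factor_closure.
have equality X : Bplus X -> op_prod X clB0 `<=` T -> dom T `<=` dom clB0 ->
    T = op_prod X clB0.
  move=> [_ dX _] XT TC; apply/seteqP; split=> // -[x y] Txy.
  have [b Cxb] : dom clB0 x by apply: TC; exists y.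
  have [z Xbz] : dom X b by rewrite dX.
  have Pxz : op_prod X clB0 (x, z) by exists b.
  by rewrite (op_fun lT Txy (XT _ Pxz)).
have domT X : T = op_prod X clB0 -> dom T `<=` dom clB0.
  by move=> -> x [y [b [/= h _]]]; exists b.
have kerX X : Bplus X -> T = op_prod X clB0 -> ker X `<=` ker (adjoint T).
  move=> [[sX _] _ _] eT z /= Xz0; apply/(adjoint_rip _ _ sT) => u v.
  rewrite eT => -[b [/= _ Xbv]].
  by rewrite (selfadjoint_rip sX Xbv Xz0) !rip0r.
split.
- split=> [[l [l0 /(i_ii _ l0)[X [bX XT _ _]]]]|[X [bX XT]]]; first by exists X.
  by have [h _ _ _] := ii_i _ bX XT; exists (opnorm X); have [m0 _] := opnormP bX.
- by move=> X bX /(ii_i _ bX)[].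
- exact: i_ii.
- split=> [[[l [l0 h]] TC]|[X [bX eT]]].
    have eTB : TB = TclB0.
      by apply: selfadjoint_max => //; have [_ [sC _] _] := h.
    rewrite -eTB in h; have [X [bX XT _ _]] := i_ii _ l0 h.
    by exists X; split=> //; exact: equality.
  have XT : op_prod X clB0 `<=` T by rewrite -eT.
  have [h1 _ _ ->] := ii_i _ bX XT; have [m0 _] := opnormP bX.
  by split; [exists (opnorm X)|exact: domT eT].
- move=> [X [bX eT]].
  have XT : op_prod X clB0 `<=` T by rewrite -eT.
  have [h1 _ _ _] := ii_i _ bX XT; have [m0 _] := opnormP bX.
  split.
    have [X' [bX' XT' kX' _]] := i_ii _ m0 h1.
    have eT' := equality _ bX' XT' (domT _ eT).
    by exists X'; split=> //; apply/seteqP; split=> //; exact: kerX.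
  by move=> Y bY eTY kY; apply/seteqP; split=> //; exact: kerX.
Qed.
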